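(* Let $n\in\mathbb N$, $\delta=(n,n-1,\ldots,1)$, $\mu$ a partition with at most $n$ non-zero parts and $\lambda=\mu+\delta$. Let $x_1,\ldots,x_n,y_1,\ldots,y_n,z_0$ be non-zero parameters and $\boldsymbol{z}=(x_1,\ldots,x_n,z_0,\overline{y}_n,\ldots,\overline{y}_1)$. Then $$\sum_{P\in\mathcal P^\lambda(2n+1)}\mathrm{wgt}(P)=\sum_{P\in\mathcal P^\delta(2n+1)}\mathrm{wgt}(P)\ \sum_{\gamma\in\mathcal C}s_{\mu/\gamma}(\boldsymbol{z}),$$ with $$\sum_{P\in\mathcal P^\delta(2n+1)}\mathrm{wgt}(P)=\prod_{i=1}^n x_i^{-(n-i)}\prod_{i=1}^n(1+z_0x_i)\prod_{1\le i<j\le n}(1+x_ix_j)(1+x_i\overline{y}_j).$$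
   Context: $\overline{w}$ denotes $w^{-1}$. Consider the totally ordered alphabet $1'<1<2'<2<\cdots<n'<n<0'<0<\overline{n}'<\overline{n}<\cdots<\overline{1}'<\overline{1}$ (primed and unprimed letters). For a strict partition $\lambda=(\lambda_1>\cdots>\lambda_n>0)$ the shifted diagram consists of boxes $(i,j)$, $1\le i\le n$, $i\le j\le i+\lambda_i-1$; boxes $(i,i)$ form the main diagonal; a diagonal is a set of boxes with $j-i$ fixed. $\mathcal P^\lambda(2n+1)$ is the set of fillings of the shifted diagram by letters of the alphabet such that entries weakly increase along rows and down columns, strictly increase along diagonals (from $(i,j)$ to $(i+1,j+1)$), no two equal primed letters lie in a row, no two equal unprimed letters lie in a column, all main-diagonal entries are unprimed and for each $k=1,\ldots,n$ exactly one of $k,\overline{k}$ is on the main diagonal. $\mathrm{wgt}(P)=\prod_{e\in P}\mathrm{wgt}(e)$ with: diagonal $k\mapsto z_0x_k\prod_{j>k}x_j\overline{y}_j$, diagonal $\overline{k}\mapsto1$; off-diagonal $k\mapsto x_k$, $k'\mapsto y_k$, $\overline{k}\mapsto\overline{y}_k$, $\overline{k}'\mapsto\overline{x}_k$, $0\mapsto z_0$, $0'\mapsto\overline{z}_0$. $\mathcal C$ is the set of partitions $\gamma$ (including the empty one) which in Frobenius notation have the form $(a_1,\ldots,a_r\mid a_1-1,\ldots,a_r-1)$, i.e. each arm length exceeds the corresponding leg length by $1$. $s_{\mu/\gamma}(\boldsymbol{z})$ is the skew Schur function in the $2n+1$ variables $\boldsymbol{z}$ (zero unless $\gamma\subseteq\mu$).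 *)

(* Defs.v *)
From HB Require Import structures.
From mathcomp Require Import all_boot all_order all_algebra.
From mathcomp Require Import boolp classical_sets functions cardinality fsbigop.
Set Implicit Arguments.
Unset Strict Implicit.
Unset Printing Implicit Defensive.
Import GRing.Theory.
Local Open Scope ring_scope.

(* Rows, columns, parts and the labels 1, ..., n are numbered from 0: the label
   k of the text is the element of 'I_n with value k - 1. *)

(* Partitions are weakly decreasing sequences of positive integers; [nth 0 s i]
   is the i-th part, equal to 0 beyond the length. *)
Definition is_part (s : seq nat) : bool := sorted geq s && (0%N \notin s).

Definition part_le (g s : seq nat) : bool :=
  all (fun i => nth 0 g i <= nth 0 s i)%N (iota 0 (size g)).

Definition conj_part (s : seq nat) (j : nat) : nat := count (fun p => j < p)%N s.

Definition durfee (s : seq nat) : nat :=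
  count (fun i => i < nth 0 s i)%N (iota 0 (size s)).

Definition arm (s : seq nat) (i : nat) : nat := (nth 0 s i - i.+1)%N.
Definition leg (s : seq nat) (i : nat) : nat := (conj_part s i - i.+1)%N.

Definition arm_leg_parts : set (seq nat) :=
  [set g | is_part g /\
           (forall i, (i < durfee g)%N -> arm g i = (leg g i).+1)]%classic.

Definition staircase (n : nat) : seq nat := mkseq (fun i => n - i)%N n.

Definition add_staircase (n : nat) (mu : seq nat) : seq nat :=
  mkseq (fun i => nth 0 mu i + (n - i))%N n.

Definition shifted_diag (lam : seq nat) : seq (nat * nat) :=
  [seq (i, j) | i <- iota 0 (size lam), j <- iota i (nth 0 lam i)].

Definition skew_diag (mu g : seq nat) : seq (nat * nat) :=
  [seq (i, j) | i <- iota 0 (size mu),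
                j <- iota (nth 0 g i) (nth 0 mu i - nth 0 g i)].

Definition row_of (s : seq (nat * nat)) (b : seq_sub s) : nat := (val b).1.
Definition col_of (s : seq (nat * nat)) (b : seq_sub s) : nat := (val b).2.

Definition is_ssyt (m : nat) (s : seq (nat * nat))
    (T : {ffun seq_sub s -> 'I_m}) : bool :=
  [forall b, forall c,
     ((row_of b == row_of c) && (col_of b < col_of c)%N ==> (T b <= T c)%N)
  && ((col_of b == col_of c) && (row_of b < row_of c)%N ==> (T b < T c)%N)].

Definition skew_schur (R : comPzRingType) (z : seq R) (mu g : seq nat) : R :=
  if part_le g mu then
    \sum_(T : {ffun seq_sub (skew_diag mu g) -> 'I_(size z)} | is_ssyt T)
      \prod_b z`_(T b)
  else 0.

Inductive symbol (n : nat) : Type :=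
  | Plain of 'I_n
  | Zero
  | Bar of 'I_n.
Arguments Zero {n}.

Definition sum_of_symbol n (a : symbol n) : 'I_n + (unit + 'I_n) :=
  match a with
  | Plain k => inl k
  | Zero => inr (inl tt)
  | Bar k => inr (inr k)
  end.
Definition symbol_of_sum n (a : 'I_n + (unit + 'I_n)) : symbol n :=
  match a with
  | inl k => Plain k
  | inr (inl _) => Zero
  | inr (inr k) => Bar k
  end.
Lemma sum_of_symbolK n : cancel (@sum_of_symbol n) (@symbol_of_sum n).
Proof. by case. Qed.
HB.instance Definition _ n := Finite.copy (symbol n) (can_type (@sum_of_symbolK n)).

(* A letter is a symbol together with a flag telling whether it is primed. *)
Notation letter n := (symbol n * bool)%type.

Definition primed n (a : letter n) : bool := a.2.

Definition symbol_rank n (a : symbol n) : nat :=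
  match a with
  | Plain k => k
  | Zero => n
  | Bar k => n.*2 - k
  end.

(* Position in 1' < 1 < ... < n' < n < 0' < 0 < nbar' < nbar < ... < 1bar. *)
Definition rank n (a : letter n) : nat := ((symbol_rank a.1).*2 + ~~ primed a)%N.

Definition on_diag (s : seq (nat * nat)) (b : seq_sub s) : bool :=
  row_of b == col_of b.

Definition is_primed_tableau (n : nat) (lam : seq nat)
    (P : {ffun seq_sub (shifted_diag lam) -> letter n}) : bool :=
  [&& [forall b, forall c,
        (row_of b == row_of c) && (col_of b < col_of c)%N ==>
        (rank (P b) <= rank (P c))%N],
      [forall b, forall c,
        (col_of b == col_of c) && (row_of b < row_of c)%N ==>
        (rank (P b) <= rank (P c))%N],
      [forall b, forall c,
        (row_of c == (row_of b).+1) && (col_of c == (col_of b).+1) ==>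
        (rank (P b) < rank (P c))%N],
      [forall b, forall c,
        [&& b != c, row_of b == row_of c & P b == P c] ==> ~~ primed (P b)],
      [forall b, forall c,
        [&& b != c, col_of b == col_of c & P b == P c] ==> primed (P b)],
      [forall b, on_diag b ==> ~~ primed (P b)]
    & [forall k : 'I_n, #|[set b | on_diag b &
         (P b == (Plain k, false)) || (P b == (Bar k, false))]| == 1%N]].

(* The value 1 at the symbol 0 is never used: in a primed tableau the n boxes
   of the main diagonal carry exactly one of k, kbar for each k. *)
Definition wgt_diag (F : fieldType) (n : nat) (x y : 'I_n -> F) (z0 : F)
    (a : letter n) : F :=
  match a.1 with
  | Plain k => z0 * x k * \prod_(j < n | (k < j)%N) (x j * (y j)^-1)
  | Zero => 1
  | Bar _ => 1
  end.

Definition wgt_offdiag (F : fieldType) (n : nat) (x y : 'I_n -> F) (z0 : F)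
    (a : letter n) : F :=
  match a with
  | (Plain k, false) => x k
  | (Plain k, true) => y k
  | (Zero, false) => z0
  | (Zero, true) => z0^-1
  | (Bar k, false) => (y k)^-1
  | (Bar k, true) => (x k)^-1
  end.

Definition wgt (F : fieldType) (n : nat) (x y : 'I_n -> F) (z0 : F)
    (lam : seq nat) (P : {ffun seq_sub (shifted_diag lam) -> letter n}) : F :=
  \prod_b (if on_diag b then wgt_diag x y z0 (P b)
           else wgt_offdiag x y z0 (P b)).

Definition tableau_sum (F : fieldType) (n : nat) (x y : 'I_n -> F) (z0 : F)
    (lam : seq nat) : F :=
  \sum_(P : {ffun seq_sub (shifted_diag lam) -> letter n} | is_primed_tableau P)
    wgt x y z0 P.

(* (x_1, ..., x_n, z_0, 1/y_n, ..., 1/y_1) *)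
Definition zvec (F : fieldType) (n : nat) (x y : 'I_n -> F) (z0 : F) : seq F :=
  codom x ++ z0 :: rev (codom (fun i => (y i)^-1)).

(* Main.v *)
(* Both sides are determinants.  Removing the cells that carry the largest letter
   turns a sum over fillings into a sum over smaller shapes, and a determinant
   with columns indexed by the rows of the shape obeys the same recursion, by
   multilinearity for a primed letter and after subtracting from each column a
   multiple of the next one for an unprimed letter.  Hence s_{mu/gamma}(z) is
   the Jacobi-Trudi determinant, and the tableaux with a prescribed main
   diagonal d_1 < ... < d_n contribute det [t^lambda_j] q_{d_i}(t), where
   q_d(t) = c_d t/(1 - z_d t) prod_{a > d} (1 + w_a t)/(1 - z_a t) and c_d is the
   weight of the diagonal letter d.

   Number the symbols 1, ..., n, 0, nbar, ..., 1bar by 0, ..., 2n.  A strictly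
   increasing sequence of n numbers q_i contains exactly one of k and 2n - k for
   each k < n if and only if no q_i + q_j equals 2n.  This condition describes
   the main diagonals of the tableaux, and also, with q_i = gamma_i + n - i, the
   partitions gamma of C with at most n parts.  It is detected by the determinant
   of the n x n matrix whose column j is the unit vector of k if q_j = k and
   (-1)^(n-1-k) times that vector if q_j = 2n - k, so the Cauchy-Binet formula
   turns each side into one determinant.

   With H(t) = prod_a 1/(1 - z_a t), the tableau sum becomes
   det [t^lambda_j] t N_k(t) H(t) for explicit polynomials N_k of degree 2n with
   t^2n N_k(-1/t) = (-1)^(n-1) N_k(t) and N_k divisible by 1 + t^2.  They are
   therefore combinations of the polynomials t^k + (-1)^(n-1-k) t^(2n-k) that
   occur in the determinant for the sum over gamma, and the change of basis
   factors through a Newton basis in which it is triangular: its determinant is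
   the product formula. *)

Require Import Defs.
From mathcomp Require Import all_boot all_order all_fingroup all_algebra.
From mathcomp Require Import boolp classical_sets functions cardinality fsbigop.
From mathcomp Require Import zify ring.
Set Implicit Arguments.
Unset Strict Implicit.
Unset Printing Implicit Defensive.
Import GRing.Theory.
Local Open Scope ring_scope.

(** * Determinants and the Cauchy-Binet formula *)

Section LinearAlgebra.
Variable R : comNzRingType.

Lemma det_col_form n (A : 'M[R]_n) :
  \det A = \sum_(s : 'S_n) (-1) ^+ s * \prod_j A (s j) j.
Proof.
by rewrite -det_tr; apply: eq_bigr => s _; congr (_ * _); apply: eq_bigr => j _;
   rewrite mxE.
Qed.

(** Multilinearity in the columns. The scalar [c j q] does not depend on the row; in the recursions
    below it carries the weight of the cells removed from row [j] of a shape. *)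
Lemma det_sum_cols (J : finType) n (c : 'I_n -> J -> R)
    (f : 'I_n -> 'I_n -> J -> R) :
  \det (\matrix_(i, j) \sum_q c j q * f i j q) =
  \sum_(l : {ffun 'I_n -> J})
     (\prod_j c j (l j)) * \det (\matrix_(i, j) f i j (l j)).
Proof.
rewrite det_col_form.
under eq_bigr => s _.
  under eq_bigr => j _ do rewrite mxE.
  rewrite bigA_distr_bigA big_distrr /=.
  over.
rewrite exchange_big; apply: eq_bigr => l _.
rewrite det_col_form big_distrr /=; apply: eq_bigr => s _.
rewrite big_split /= mulrCA; congr (_ * (_ * _)).
by apply: eq_bigr => j _; rewrite mxE.
Qed.

(** Right multiplication by a lower bidiagonal matrix with unit diagonal. All columns change at
    once, each by the original next column. *)
Lemma det_col_add_next n (g : 'I_n -> nat -> R) (a : nat -> R) :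
  \det (\matrix_(i < n, j < n)
          (g i j - (if (j.+1 < n)%N then a j * g i j.+1 else 0))) =
  \det (\matrix_(i < n, j < n) g i j).
Proof.
pose T : 'M[R]_n :=
  \matrix_(i, j) ((i == j)%:R - (i == j.+1 :> nat)%:R * a j).
have -> : \matrix_(i < n, j < n)
   (g i j - (if (j.+1 < n)%N then a j * g i j.+1 else 0)) =
   (\matrix_(i < n, j < n) g i j) *m T.
  apply/matrixP => i j; rewrite !mxE.
  under eq_bigr => k _ do rewrite !mxE mulrBr.
  rewrite sumrB; congr (_ - _).
    rewrite (bigD1 j) //= eqxx mulr1 big1 ?addr0 // => k /negPf ->.
    by rewrite mulr0.
  case: ifP => jn.
    rewrite (bigD1 (Ordinal jn)) //= eqxx mul1r mulrC big1 ?addr0 // => k kj.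
    suff -> : (k == j.+1 :> nat) = false by rewrite mul0r mulr0.
    by apply/negbTE; apply: contra kj => /eqP e; apply/eqP/val_inj.
  rewrite big1 // => k _; case: eqP => [e|_]; last by rewrite mul0r mulr0.
  by have := ltn_ord k; rewrite e jn.
rewrite det_mulmx (@det_trig _ _ T) ?big1 ?mulr1 //.
  move=> i _; rewrite mxE eqxx; case: eqP => [e|]; last by rewrite mul0r subr0.
  lia.
apply/is_trig_mxP => i j ij; rewrite mxE.
have -> : (i == j) = false by apply/negbTE/eqP => e; move: ij; rewrite e ltnn.
have -> : (i == j.+1 :> nat) = false by apply/negbTE; lia.
by rewrite mul0r subr0.
Qed.

Lemma det_row0 n (A : 'M[R]_n) i : (forall j, A i j = 0) -> \det A = 0.
Proof. by move=> Ai; rewrite (expand_det_row _ i) big1 // => j _; rewrite Ai mul0r. Qed.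

Lemma det_col0 n (A : 'M[R]_n) j : (forall i, A i j = 0) -> \det A = 0.
Proof. by move=> Aj; rewrite (expand_det_col _ j) big1 // => i _; rewrite Aj mul0r. Qed.

Lemma det_eq_cols n (A : 'M[R]_n) j1 j2 :
  j1 != j2 -> (forall i, A i j1 = A i j2) -> \det A = 0.
Proof.
move=> ne Aj; rewrite -det_tr; apply: (determinant_alternate ne) => i.
by rewrite !mxE.
Qed.

(** Pigeonhole: no permutation sends the [k + 1] first rows into the [k] columns outside the zero
    block. *)
Lemma det_zero_block n (A : 'M[R]_n) (k : 'I_n) :
  (forall i j : 'I_n, (i <= k)%N -> (k <= j)%N -> A i j = 0) -> \det A = 0.
Proof.
move=> A0; rewrite /determinant big1 // => s _.
suff /existsP[i /andP[ik ki]] : [exists i : 'I_n, (i <= k)%N && (k <= s i)%N].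
  by rewrite (bigD1 i) //= A0 // mul0r mulr0.
apply: contraT => /existsPn H.
have : (\sum_(i < n) (i <= k) <= \sum_(i < n) (i < k))%N.
  rewrite [X in (_ <= X)%N](reindex_perm s); apply: leq_sum => i _.
  by have := H i; case: (leqP i k) => //= _; rewrite -ltnNge => ->.
have -> : (\sum_(i < n) (i <= k) = \sum_(i < n) (i < k) + \sum_(i < n) (i == k))%N.
  rewrite -big_split; apply: eq_bigr => i _ /=; rewrite -val_eqE /=.
  by case: ltngtP.
by rewrite -[X in (_ <= X)%N]addn0 leq_add2l (bigD1 k) //= eqxx.
Qed.

(** Reversing rows and columns conjugates every permutation, which keeps its sign. *)
Lemma det_rev n (A : 'M[R]_n) :
  \det (\matrix_(i, j) A (rev_ord i) (rev_ord j)) = \det A.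
Proof.
rewrite /determinant (reindex_inj (h := fun s : 'S_n => conjg s (perm rev_ord_inj)));
  last exact: conjg_inj.
apply: eq_bigr => s _; rewrite odd_permJ; congr (_ * _).
rewrite (reindex_inj rev_ord_inj) /=; apply: eq_bigr => i _.
rewrite mxE rev_ordK; congr (A _ _).
have e : rev_ord i = (perm rev_ord_inj) i by rewrite permE.
by rewrite e permJ permE rev_ordK.
Qed.

Definition incr n p (q : {ffun 'I_n -> 'I_p}) : bool :=
  [forall i : 'I_n, forall j : 'I_n, (i < j)%N ==> (q i < q j)%N].

Lemma incrP n p (q : {ffun 'I_n -> 'I_p}) :
  reflect (forall i j : 'I_n, (i < j)%N -> (q i < q j)%N) (incr q).
Proof.
apply: (iffP forallP) => H i; last by apply/forallP => j; apply/implyP/H.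
by move=> j; have /forallP/(_ j)/implyP := H i.
Qed.

Lemma sum_lt_ord n m : (m <= n)%N -> (\sum_(i < n) (i < m))%N = m.
Proof.
move=> mn; transitivity (\sum_(i < n | (i < m)%N) 1)%N.
  by rewrite [RHS]big_mkcond; apply: eq_bigr => i _; case: (_ < _)%N.
by rewrite (big_ord_narrow mn) /= sum1_card card_ord.
Qed.

(** For injective [l] these ranks form the permutation [s] such that [l] is an increasing sequence
    composed with [s]. *)
Definition ord_pos n p (l : {ffun 'I_n -> 'I_p}) (i : 'I_n) : nat :=
  \sum_(k < n) (l k < l i)%N.

Lemma ord_pos_comp n p (q : {ffun 'I_n -> 'I_p}) (s : 'S_n) :
  injectiveb [ffun j => q (s j)] &&
    [forall i, ord_pos [ffun j => q (s j)] i == s i] = incr q.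
Proof.
apply/andP/idP => [[_ /forallP H]|/incrP H].
  apply/incrP => a b ab; rewrite ltnNge; apply/negP => qba.
  have ea := eqP (H (s^-1%g a)); have eb := eqP (H (s^-1%g b)).
  rewrite permKV in ea; rewrite permKV in eb.
  move: ab; rewrite -ea -eb ltnNge => /negP[].
  by apply: leq_sum => k _; rewrite !ffunE !permKV; case: (ltnP (q _) (q b)) => // h;
     rewrite (leq_trans h).
have Hlt i j : (q i < q j)%N = (i < j)%N.
  case: (ltngtP i j) => [/H -> //|/H h|/val_inj ->]; last by rewrite ltnn.
  by apply/negbTE; rewrite -leqNgt ltnW.
split.
  apply/injectiveP => i j; rewrite !ffunE => e; apply: (@perm_inj _ s).
  by apply/val_inj; case: (ltngtP (s i) (s j)) => //= h; have := Hlt (s i) (s j);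
     have := Hlt (s j) (s i); rewrite e h ltnn.
apply/forallP => i; apply/eqP; rewrite /ord_pos.
under eq_bigr => k _ do rewrite !ffunE Hlt.
transitivity (\sum_(k < n) (k < s i))%N; last by rewrite sum_lt_ord // ltnW.
by rewrite [RHS](reindex_perm s).
Qed.

(** Uniqueness is put as a Boolean equality so that a one-term sum over [s] can be inserted and
    exchanged with the outer sum. *)
Lemma ord_pos_perm n p (l : {ffun 'I_n -> 'I_p}) :
  injectiveb l ->
  exists s0 : 'S_n, forall s : 'S_n, [forall i, ord_pos l i == s i] = (s == s0).
Proof.
move=> /injectiveP linj.
have plt i : (ord_pos l i < n)%N.
  rewrite /ord_pos (bigD1 i) //= ltnn add0n.
  apply: leq_ltn_trans (_ : (\sum_(k < n | k != i) 1 < n)%N).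
    by apply: leq_sum => k _; case: (_ < _)%N.
  by have := sum1_card 'I_n; rewrite (bigD1 i) //= card_ord add1n => h; rewrite -ltnS h.
have pmon i j : (l i < l j)%N -> (ord_pos l i < ord_pos l j)%N.
  move=> lij; rewrite /ord_pos [X in (_ < X)%N](bigD1 i) //= lij.
  rewrite (bigD1 i) //= ltnn add0n ltnS; apply: leq_sum => k _.
  by case: (ltnP (l k) (l i)) => // h; rewrite (ltn_trans h lij).
have pinj : injective (fun i => Ordinal (plt i)).
  move=> i j /(congr1 val) /= e; apply: linj; apply/val_inj/eqP.
  by case: ltngtP => // /pmon; rewrite e ltnn.
exists (perm pinj) => s; apply/forallP/eqP => [H|->].
  by apply/permP => i; rewrite permE; apply/val_inj; rewrite /= (eqP (H i)).
by move=> i; rewrite permE.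
Qed.

(** Expansion by columns: a repeated index gives two equal columns, and an injective choice is
    uniquely an increasing [q] composed with a permutation. The sum over permutations restores the
    second determinant. *)
Lemma cauchy_binet n p (A : 'I_n -> 'I_p -> R) (B : 'I_p -> 'I_n -> R) :
  \det (\matrix_(i, j) \sum_q A i q * B q j) =
  \sum_(q : {ffun 'I_n -> 'I_p} | incr q)
    \det (\matrix_(i, j) A i (q j)) * \det (\matrix_(i, j) B (q i) j).
Proof.
under eq_mx do under eq_bigr => q _ do rewrite mulrC.
rewrite (det_sum_cols (fun j q => B q j) (fun i _ q => A i q)).
rewrite (bigID (fun l : {ffun 'I_n -> 'I_p} => injectiveb l)) /= addrC big1 ?add0r;
  last first.
  move=> l /injectivePn[i [j ij lij]].
  rewrite (@det_eq_cols _ _ i j) ?mulr0 // => k; first by rewrite !mxE lij.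
transitivity (\sum_(l : {ffun 'I_n -> 'I_p} | injectiveb l)
   \sum_(s : 'S_n | [forall i, ord_pos l i == s i])
    (\prod_j B (l j) j) * \det (\matrix_(i, j) A i (l j))).
  apply: eq_bigr => l linj; have [s0 Hs] := ord_pos_perm linj.
  by rewrite (eq_bigl _ _ Hs) big_pred1_eq.
rewrite (exchange_big_dep xpredT) //=.
transitivity (\sum_(s : 'S_n) \sum_(q : {ffun 'I_n -> 'I_p} | incr q)
   (\prod_j B (q (s j)) j) * ((-1) ^+ s * \det (\matrix_(i, j) A i (q j)))).
  apply: eq_bigr => s _.
  pose h (q : {ffun 'I_n -> 'I_p}) := [ffun j => q (s j)].
  pose h' (q : {ffun 'I_n -> 'I_p}) := [ffun j => q (s^-1%g j)].
  have hK : cancel h h' by move=> q; apply/ffunP => j; rewrite !ffunE permKV.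
  have h'K : cancel h' h by move=> q; apply/ffunP => j; rewrite !ffunE permK.
  rewrite (reindex h); last by exists h' => q _; rewrite ?hK ?h'K.
  apply: eq_big => [q|q _]; first exact: ord_pos_comp.
  congr (_ * _); first by apply: eq_bigr => j _; rewrite ffunE.
  rewrite -odd_permV -det_perm mulrC -det_mulmx -col_permE.
  by congr (\det _); apply/matrixP => i j; rewrite !mxE ffunE.
rewrite exchange_big; apply: eq_bigr => q _ /=.
rewrite [in RHS]mulrC [X in _ = X * _]det_col_form big_distrl /=.
apply: eq_bigr => s _; rewrite mulrCA mulrA; congr (_ * _ * _).
by apply: eq_bigr => j _; rewrite mxE.
Qed.

End LinearAlgebra.

(** * Fillings, one letter at a time *)

Lemma find_initial_segment (p : pred nat) (b e : nat) :
  (b <= e)%N ->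
  (forall j j', b <= j -> j <= j' -> j' < e -> p j' -> p j)%N ->
  exists2 e', (b <= e' <= e)%N & forall j, (b <= j < e)%N -> p j = (j < e')%N.
Proof.
move=> be pdown; pose s := iota b (e - b); pose k := find (predC p) s.
have ks : (k <= e - b)%N by have := find_size (predC p) s; rewrite size_iota.
exists (b + k)%N => [|j /andP[bj je]]; first lia.
case: ltnP => jk.
  have h : (j - b < k)%N by lia.
  have := before_find 0%N h; rewrite nth_iota ?subnKC //=; last lia.
  by move/negbFE.
apply/negbTE/negP => pj.
have hs : has (predC p) s by rewrite has_find size_iota -/k; lia.
have := nth_find 0%N hs; rewrite -/k nth_iota; last lia.
by move=> /negP[]; apply: (pdown _ j) => //; lia.
Qed.

Lemma big_seq_sub (R : Type) (idx : R) (op : Monoid.com_law idx) (T : choiceType)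
    (s : seq T) (f : T -> R) :
  uniq s -> \big[op/idx]_(c : seq_sub s) f (val c) = \big[op/idx]_(c <- s) f c.
Proof.
transitivity (\big[op/idx]_(c <- map val (enum {: seq_sub s})) f c).
  by rewrite big_map big_enum.
apply: perm_big.
apply: uniq_perm => //; first by rewrite map_inj_uniq ?enum_uniq //; apply: val_inj.
move=> c; apply/mapP/idP => [[x _ ->]|cs]; first exact: valP x.
by exists (SeqSub cs); rewrite ?mem_enum.
Qed.

(** One encoding for skew diagrams, with [b] the inner partition, and shifted diagrams, with
    [b = id]. *)
Definition cells (m : nat) (b e : nat -> nat) : seq (nat * nat) :=
  [seq (i, j) | i <- iota 0 m, j <- iota (b i) (e i - b i)].

Lemma mem_cells m b e i j :
  ((i, j) \in cells m b e) = [&& i < m, b i <= j & j < e i]%N.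
Proof.
apply/allpairsPdep/idP => [[i' [j' [+ + [-> ->]]]]|/and3P[im bj je]].
  by rewrite !mem_iota; lia.
by exists i, j; rewrite !mem_iota; split => //; lia.
Qed.

Lemma uniq_cells m b e : uniq (cells m b e).
Proof.
apply: allpairs_uniq_dep => [|i _|]; rewrite ?iota_uniq //.
by move=> [i j] [i' j'] _ _ /= [-> ->].
Qed.

Lemma big_cells (R : Type) (idx : R) (op : Monoid.com_law idx) m b e
    (f : nat * nat -> R) :
  \big[op/idx]_(c <- cells m b e) f c =
  \big[op/idx]_(i < m) \big[op/idx]_(b i <= j < e i) f (i : nat, j).
Proof.
rewrite big_allpairs_dep -(big_mkord xpredT (fun i => \big[op/idx]_(b i <= j < e i) f (i, j))).
by rewrite /index_iota subn0.
Qed.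

(** Shapes are functions on [nat], but sums over shapes need a finite type; [ext] passes from the
    second to the first. *)
Definition ext m N (e : {ffun 'I_m -> 'I_N}) (i : nat) : nat :=
  oapp (fun k => val (e k)) 0%N (insub i).

Lemma extE m N (e : {ffun 'I_m -> 'I_N}) (k : 'I_m) : ext e k = e k.
Proof. by rewrite /ext valK. Qed.

Section Fillings.
Variables (A : finType) (rk : A -> nat) (pr : nat -> bool).

(* Letters of equal rank are equal: a primed letter occurs at most once in a row,
   an unprimed one at most once in a column. *)
Definition row_ok (x y : A) : bool :=
  (rk x < rk y)%N || (x == y) && ~~ pr (rk x).
Definition col_ok (x y : A) : bool :=
  (rk x < rk y)%N || (x == y) && pr (rk x).

Definition valid (s : seq (nat * nat)) (P : {ffun seq_sub s -> A}) : bool :=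
  [forall b, forall c,
     ((row_of b == row_of c) && (col_of b < col_of c)%N ==> row_ok (P b) (P c))
  && ((col_of b == col_of c) && (row_of b < row_of c)%N ==> col_ok (P b) (P c))].

Definition below (r : nat) (s : seq (nat * nat)) (P : {ffun seq_sub s -> A}) :
  bool := [forall c, rk (P c) < r]%N.

Definition validf (s : seq (nat * nat)) (f : nat * nat -> A) : Prop :=
  (forall i j j', (i, j) \in s -> (i, j') \in s -> (j < j')%N ->
     row_ok (f (i, j)) (f (i, j'))) /\
  (forall i i' j, (i, j) \in s -> (i', j) \in s -> (i < i')%N ->
     col_ok (f (i, j)) (f (i', j))).

(** The default matters: with [a] the letter of rank [r], reading a filling on a larger shape puts
    [a] into the added cells. *)
Definition entry (a : A) (s : seq (nat * nat)) (P : {ffun seq_sub s -> A})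
  (c : nat * nat) : A := oapp P a (insub c).

Lemma entry_val a s (P : {ffun seq_sub s -> A}) c : entry a P (val c) = P c.
Proof. by rewrite /entry valK. Qed.

Lemma entry_out a s (P : {ffun seq_sub s -> A}) c : c \notin s -> entry a P c = a.
Proof. by move=> cs; rewrite /entry insubN. Qed.

Lemma validP a s (P : {ffun seq_sub s -> A}) :
  reflect (validf s (entry a P)) (valid P).
Proof.
apply: (iffP forallP) => [H|[Hr Hc] [[i j] cs]].
  split=> [i j j' c c'|i i' j c c'] lt.
    have /forallP/(_ (SeqSub c'))/andP[/implyP h _] := H (SeqSub c).
    by rewrite -[(i, j)]/(val (SeqSub c)) -[(i, j')]/(val (SeqSub c')) !entry_val h //=
       /row_of /col_of /= eqxx.
  have /forallP/(_ (SeqSub c'))/andP[_ /implyP h] := H (SeqSub c).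
  by rewrite -[(i, j)]/(val (SeqSub c)) -[(i', j)]/(val (SeqSub c')) !entry_val h //=
       /row_of /col_of /= eqxx.
apply/forallP => -[[i' j'] cs']; rewrite -!(entry_val a) /row_of /col_of /=.
apply/andP; split; apply/implyP => /andP[/eqP e lt]; subst.
  exact: Hr.
exact: Hc.
Qed.

Lemma belowP a r s (P : {ffun seq_sub s -> A}) :
  reflect (forall c, c \in s -> rk (entry a P c) < r)%N (below r P).
Proof.
apply: (iffP forallP) => [H c cs|H c]; 
  last by rewrite -(entry_val a); apply: H; apply: (valP c).
by rewrite -[c]/(val (SeqSub cs)) entry_val.
Qed.

(* The cells of the shape e outside the shape e' can all be given the letter of
   rank r. *)
Definition step (m : nat) (b : nat -> nat) (r : nat) (e' e : nat -> nat) : Prop :=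
  [/\ forall i, (i < m)%N -> (b i <= e' i <= e i)%N,
      forall i, pr r -> (i < m)%N -> (e i <= (e' i).+1)%N &
      forall i i' j, (i < i')%N -> (i' < m)%N -> (e' i <= j < e i)%N ->
        (b i' <= j < e i')%N -> pr r /\ (e' i' <= j)%N].

Variable (R : comNzRingType).

Definition fsum (wt : nat * nat -> nat -> R) (r : nat) (s : seq (nat * nat)) : R :=
  \sum_(P : {ffun seq_sub s -> A} | valid P && below r P)
     \prod_c wt (val c) (rk (P c)).

Lemma fsum0 wt s : fsum wt 0 s = (s == [::])%:R.
Proof.
rewrite /fsum; case: s => [|c s] /=.
  have noc (c : seq_sub ([::] : seq (nat * nat))) : False by case: c.
  rewrite (big_pred1 [ffun c => match noc c with end]).
    by rewrite big1 // => c; case: (noc c).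
  move=> P /=; transitivity true; last first.
    by apply/esym/eqP/ffunP => c; case: (noc c).
  by apply/andP; split; apply/forallP => c; case: (noc c).
rewrite big1 // => P /andP[_ /forallP H].
by have := H (SeqSub (mem_head c s)).
Qed.

Hypothesis rk_inj : injective rk.
Variables (m N : nat) (b e : nat -> nat) (r : nat) (a : A).
Hypothesis ra : rk a = r.
Hypothesis be : forall i, (i < m)%N -> (b i <= e i)%N.
Hypothesis eN : forall i, (i < m)%N -> (e i < N)%N.

Definition split_at (P : {ffun seq_sub (cells m b e) -> A}) (e' : nat -> nat) :=
  (forall i, (i < m)%N -> (b i <= e' i <= e i)%N) /\
  (forall i j, (i, j) \in cells m b e -> (rk (entry a P (i, j)) < r)%N = (j < e' i)%N).

Lemma row_ok_rk x y : row_ok x y -> (rk x <= rk y)%N.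
Proof. by case/orP => [/ltnW //|/andP[/eqP -> _]]. Qed.

Lemma col_ok_rk x y : col_ok x y -> (rk x <= rk y)%N.
Proof. by case/orP => [/ltnW //|/andP[/eqP -> _]]. Qed.

(** Rows increase, so the letters of rank below [r] fill an initial segment of each row, and the cut
    is unique. *)
Lemma split_at_exists P : valid P -> 
  exists e0 : {ffun 'I_m -> 'I_N},
    forall e' : {ffun 'I_m -> 'I_N}, `[< split_at P (ext e') >] = (e' == e0).
Proof.
move=> /(validP a) [Pr _].
have H (i : 'I_m) : {k : 'I_N | (b i <= k <= e i)%N /\
   forall j, (b i <= j < e i)%N -> (rk (entry a P (i : nat, j)) < r)%N = (j < k)%N}.
  apply: cid.
  have pdown j j' : (b i <= j)%N -> (j <= j')%N -> (j' < e i)%N ->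
    (rk (entry a P (i : nat, j')) < r)%N -> (rk (entry a P (i : nat, j)) < r)%N.
    move=> bj jj' je; apply: leq_ltn_trans.
    move: jj'; rewrite leq_eqVlt => /orP[/eqP -> //|lt].
    by apply/row_ok_rk/Pr; rewrite ?mem_cells ?ltn_ord //=; lia.
  have [k] := find_initial_segment (be (ltn_ord i)) pdown.
  move=> bk hk; have kN : (k < N)%N by have := eN (ltn_ord i); lia.
  by exists (Ordinal kN).
exists [ffun i => sval (H i)] => e'; apply/asboolP/eqP => [[be' he']|->].
  apply/ffunP => i; rewrite ffunE; case: (H i) => k [bk hk] /=.
  have im := ltn_ord i; have := be' _ im; rewrite extE => b1.
  apply/val_inj => /=; apply/eqP; rewrite eqn_leq; apply/andP; split.
    rewrite leqNgt; apply/negP => lt.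
    have h : (b i <= k < e i)%N by lia.
    by have := hk _ h; rewrite he' ?mem_cells ?extE ?im //= ltnn lt.
  rewrite leqNgt; apply/negP => lt.
  have h : (b i <= e' i < e i)%N by lia.
  by have := hk _ h; rewrite he' ?mem_cells ?extE ?im //= ltnn lt.
split=> [i im|i j].
  by rewrite -[i]/(val (Ordinal im)) extE ffunE; case: (H _) => k [].
rewrite mem_cells => /and3P[im bj je].
rewrite -[i]/(val (Ordinal im)) extE ffunE; case: (H _) => k [_ /= -> //].
by rewrite bj.
Qed.

(** The cells past the cut all carry [a]. Hence a row has at most one of them if [r] is primed, and
    a cell below one of them must again carry [a], which requires [r] to be primed. *)
Lemma split_step P e' : valid P -> below r.+1 P -> split_at P e' -> step m b r e' e.
Proof.
move=> /(validP a) [Pr Pc] /(belowP a) Pb [be' he'].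
have Pa i j : (i < m)%N -> (e' i <= j < e i)%N -> entry a P (i, j) = a.
  move=> im h; have h2 := be' _ im; apply: rk_inj; rewrite ra.
  have hc : (i, j) \in cells m b e by rewrite mem_cells; lia.
  have nlt : (rk (entry a P (i, j)) < r)%N = false by rewrite he' //; lia.
  have := Pb _ hc; lia.
split=> // [i prr im|i i' j ii' im' h h'].
  rewrite leqNgt; apply/negP => lt; have h2 := be' _ im.
  have := Pr i (e' i) (e' i).+1; rewrite !mem_cells im /= !Pa //; try lia.
  move=> /(_ _ _ _)/orP[]; rewrite ?ra ?ltnn ?eqxx ?prr //; lia.
have im : (i < m)%N by lia.
have := Pc i i' j; have h2 := be' _ im.
have hc : (i, j) \in cells m b e by rewrite mem_cells; lia.
have hc' : (i', j) \in cells m b e by rewrite mem_cells; lia.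
move=> /(_ hc hc' ii'); rewrite Pa // /col_ok ra => H.
have H2 := Pb _ hc'; case/orP: H => [lt|/andP[/eqP e1 prr]]; 
  first by move: H2; rewrite ltnS leqNgt lt.
by split=> //; rewrite leqNgt -(he' _ _ hc') -e1 ra ltnn.
Qed.

Definition transfer s s' (P : {ffun seq_sub s -> A}) : {ffun seq_sub s' -> A} :=
  [ffun c => entry a P (val c)].

Lemma entry_transfer s s' (P : {ffun seq_sub s -> A}) c :
  c \in s' -> entry a (transfer s' P) c = entry a P c.
Proof.
by move=> cs; rewrite -[c]/(val (SeqSub cs)) entry_val ffunE.
Qed.

Lemma eq_entry s (P Q : {ffun seq_sub s -> A}) :
  (forall c, c \in s -> entry a P c = entry a Q c) -> P = Q.
Proof. by move=> H; apply/ffunP => c; rewrite -!(entry_val a); apply: H; apply: (valP c). Qed.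

Section Step.
Variable e' : nat -> nat.
Hypothesis ste : step m b r e' e.
Let s := cells m b e.
Let s' := cells m b e'.

Lemma sub_cells c : c \in s' -> c \in s.
Proof.
by case: c => i j; case: ste => h _ _; rewrite !mem_cells => /and3P[im *];
   have := h _ im; lia.
Qed.

Lemma transferK (P : {ffun seq_sub s' -> A}) : transfer s' (transfer s P) = P.
Proof.
by apply: eq_entry => c cs; rewrite !entry_transfer // sub_cells.
Qed.

Lemma transferK' (P : {ffun seq_sub s -> A}) :
  below r.+1 P -> split_at P e' -> transfer s (transfer s' P) = P.
Proof.
move=> /(belowP a) Pb [_ he']; apply: eq_entry => c cs; rewrite entry_transfer //.
case: (boolP (c \in s')) => [cs'|cs']; first by rewrite entry_transfer.
rewrite entry_out //; apply/esym/rk_inj; rewrite ra; apply/eqP.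
rewrite eqn_leq; apply/andP; split; first by rewrite -ltnS; apply: Pb.
rewrite leqNgt; case: c cs cs' => i j cs cs'.
by rewrite he' //; move: cs cs'; rewrite !mem_cells; lia.
Qed.

(** Conditions between two old cells are the same on both sides; those that involve a new cell are
    supplied by [step]. *)
Lemma transfer_valid (P : {ffun seq_sub s' -> A}) :
  [&& valid (transfer s P), below r.+1 (transfer s P) &
      `[< split_at (transfer s P) e' >]] = valid P && below r P.
Proof.
case: ste => [be' hrow hcol].
apply/and3P/andP => [[/(validP a) [Pr Pc] /(belowP a) Pb /asboolP[_ he']]|].
  split.
    apply/(validP a); split=> [i j j' c c' lt|i i' j c c' lt].
      by rewrite -(@entry_transfer s' s) ?sub_cells // -(@entry_transfer s' s)
         ?sub_cells // Pr // sub_cells.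
    by rewrite -(@entry_transfer s' s) ?sub_cells // -(@entry_transfer s' s)
         ?sub_cells // Pc // sub_cells.
  apply/(belowP a) => -[i j] c; rewrite -(@entry_transfer s' s) ?sub_cells //.
  by rewrite he' ?sub_cells //; move: c; rewrite mem_cells; lia.
move=> [/(validP a) [Pr Pc] /(belowP a) Pb].
have outa i j : (i, j) \in s -> (e' i <= j)%N -> entry a P (i, j) = a.
  by move=> c h; rewrite entry_out // mem_cells; lia.
have inb i j : (i, j) \in s -> (j < e' i)%N -> (i, j) \in s'.
  by rewrite !mem_cells; lia.
split; first 1 last.
- apply/(belowP a) => -[i j] c; rewrite entry_transfer //.
  case: (ltnP j (e' i)) => h; last by rewrite outa // ra.
  by apply: leqW; apply: Pb; apply: inb.
- apply/asboolP; split=> // i j c; rewrite entry_transfer //.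
  case: (ltnP j (e' i)) => h; last by rewrite outa // ra ltnn.
  by apply: Pb; apply: inb.
apply/(validP a); split=> [i j j' c c' lt|i i' j c c' lt]; rewrite !entry_transfer //.
  case: (ltnP j' (e' i)) => h'.
    by apply: Pr => //; apply: inb => //; lia.
  rewrite (outa _ _ c') //; case: (ltnP j (e' i)) => h.
    by rewrite /row_ok ra Pb // inb.
  rewrite outa // /row_ok ra ltnn eqxx /=; apply/negP => prr.
  by move: c c'; rewrite !mem_cells => /and3P[im _ _] /and3P[_ _ h2];
     have := hrow _ prr im; lia.
case: (ltnP j (e' i)) => h.
  case: (ltnP j (e' i')) => h'; first by apply: Pc => //; apply: inb.
  by rewrite (outa _ _ c') // /col_ok ra Pb // inb.
have [prr h'] : pr r /\ (e' i' <= j)%N.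
  move: c c'; rewrite !mem_cells => /and3P[im ? ?] /and3P[im' ? ?].
  by apply: (hcol i) => //; apply/andP.
by rewrite !outa // /col_ok ra ltnn eqxx prr.
Qed.

Lemma transfer_weight wt (P : {ffun seq_sub s' -> A}) :
  \prod_c wt (val c) (rk (transfer s P c)) =
  (\prod_(i < m) \prod_(e' i <= j < e i) wt (i : nat, j) r) *
  \prod_c wt (val c) (rk (P c)) :> R.
Proof.
case: ste => be' _ _.
pose f c := wt c (rk (entry a P c)).
under eq_bigr => c _ do rewrite ffunE -/(f (val c)).
rewrite big_seq_sub ?uniq_cells //.
under [X in _ * X]eq_bigr => c _ do rewrite -(entry_val a) -/(f (val c)).
rewrite big_seq_sub ?uniq_cells // !big_cells -big_split /=.
apply: eq_bigr => i _; have := be' _ (ltn_ord i) => /andP[h1 h2].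
rewrite (big_cat_nat h1 h2) /= mulrC; congr (_ * _).
apply: eq_big_nat => j hj; rewrite /f entry_out ?ra // mem_cells; lia.
Qed.

End Step.

(** Fillings are grouped by the shape that their letters of rank below [r] occupy. Restriction and
    extension by [a] are inverse to each other on each group. *)
Lemma fsum_step wt :
  fsum wt r.+1 (cells m b e) =
  \sum_(e' : {ffun 'I_m -> 'I_N} | `[< step m b r (ext e') e >])
    (\prod_(i < m) \prod_(e' i <= j < e i) wt (i : nat, j) r) *
    fsum wt r (cells m b (ext e')).
Proof.
rewrite /fsum.
transitivity (\sum_(P : {ffun seq_sub (cells m b e) -> A} | valid P && below r.+1 P)
  \sum_(e' : {ffun 'I_m -> 'I_N} | `[< split_at P (ext e') >])
    \prod_c wt (val c) (rk (P c))).
  apply: eq_bigr => P /andP[vP _]; have [e0 h] := split_at_exists vP.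
  by rewrite (eq_bigl _ _ h) big_pred1_eq.
rewrite (exchange_big_dep xpredT) //= [RHS]big_mkcond /=.
apply: eq_bigr => e' _; case: asboolP => ste; last first.
  rewrite big1 // => P /andP[/andP[vP bP] /asboolP sP].
  by case: ste; apply: split_step sP.
rewrite (reindex_onto (transfer (cells m b e)) (transfer (cells m b (ext e'))));
  last by move=> P /andP[/andP[_ bP] /asboolP sP]; exact: transferK' sP.
rewrite big_distrr /=; apply: eq_big => [P|P _].
  by rewrite (transferK ste) eqxx andbT -(transfer_valid ste) andbA.
rewrite (transfer_weight ste); congr (_ * _).
by apply: eq_bigr => i _; rewrite extE.
Qed.

End Fillings.

(** * Skew shapes and the Jacobi-Trudi determinant *)

Section Determinants.
Variable R : comNzRingType.

(* 1/(1 - z t) modulo t^N. *)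
Definition geom (N : nat) (z : R) : {poly R} := \poly_(i < N) z ^+ i.

Lemma coef_mul_geom N z (f : {poly R}) q : (q < N)%N ->
  (f * geom N z)`_q = \sum_(0 <= t < q.+1) f`_t * z ^+ (q - t).
Proof.
move=> qN; rewrite coefM big_mkord; apply: eq_bigr => t _.
by rewrite coef_poly (leq_ltn_trans (leq_subr _ _) qN).
Qed.

(** The terms with [t <= p] of the two coefficients are proportional and cancel. This is the column
    operation for an unprimed letter; the surviving range is that of the row ends in an interlacing
    shape. *)
Lemma coef_mul_geomB N z (f : {poly R}) p q : (p <= q)%N -> (q < N)%N ->
  (f * geom N z)`_q - z ^+ (q - p) * (f * geom N z)`_p =
  \sum_(p.+1 <= t < q.+1) f`_t * z ^+ (q - t).
Proof.
move=> pq qN; rewrite !coef_mul_geom //; last exact: leq_ltn_trans qN.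
rewrite (@big_cat_nat _ _ _ p.+1) //= big_distrr /= addrAC.
rewrite [X in X - _]big_nat [X in _ - X]big_nat -sumrB big1 ?add0r // => t /= tp.
by rewrite mulrCA -exprD (_ : q - p + (p - t) = q - t)%N ?subrr //; lia.
Qed.

Lemma sum_nat_ord a b N (F : nat -> R) : (b <= N)%N ->
  \sum_(a <= q < b) F q = \sum_(q < N) (a <= q < b)%:R * F q.
Proof.
move=> bN; rewrite (big_nat_widen _ _ _ _ _ bN) big_geq_mkord big_mkcond /=.
by apply: eq_bigr => q _; rewrite andbC; case: ifP; rewrite ?mul1r ?mul0r.
Qed.

Lemma prod_indicator n (p : pred 'I_n) (F : 'I_n -> R) :
  \prod_j ((p j)%:R * F j) = [forall j, p j]%:R * \prod_j F j.
Proof.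
rewrite big_split /=; congr (_ * _); case: forallP => [H|/forallP].
  by rewrite big1 // => j _; rewrite H.
by move=> /forallPn[j /negPf pj]; rewrite (bigD1 j) //= pj mul0r.
Qed.

Section Skew.
Variables (A : finType) (rk : A -> nat) (K : nat) (zz : nat -> R).
Hypothesis rk_inj : injective rk.
Hypothesis rk_onto : forall r, (r < K)%N -> exists a, rk a = r.
Variables (n N : nat) (b : nat -> nat).

Definition decreasing_on (e : nat -> nat) :=
  forall i, (i.+1 < n)%N -> (e i.+1 <= e i)%N.

Lemma decreasing_on_le e i j :
  decreasing_on e -> (i <= j)%N -> (j < n)%N -> (e j <= e i)%N.
Proof.
move=> de; elim: j => [|j IH]; first by rewrite leqn0 => /eqP ->.
rewrite leq_eqVlt => /orP[/eqP -> //|ij] jn.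
by apply: leq_trans (de j jn) _; apply: IH => //; lia.
Qed.

Hypothesis b_dec : decreasing_on b.

(** Without primed letters the removed cells form a horizontal strip: [e'] interlaces with [e], and
    0 stands for the absent row after the last one. *)
Lemma skew_step (r : nat) e e' : decreasing_on e ->
  (forall i, (i < n)%N -> (b i <= e i)%N) ->
  step pred0 n b r e' e <->
    (forall j, (j < n)%N ->
       ((if j.+1 < n then e j.+1 else 0) <= e' j <= e j)%N) /\
    (forall j, (j < n)%N -> (b j <= e' j)%N).
Proof.
move=> de be; split=> [[h1 _ h3]|[h1 h2]].
  split=> j jn; last by have := h1 _ jn; lia.
  have := h1 _ jn; case: ifP => [j1|_ /andP[_ -> //]] /andP[bj ->].
  rewrite andbT leqNgt; apply/negP => lt.
  have [] := h3 j j.+1 (e j.+1).-1 (ltnSn j) j1 => //.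
    by have := de _ j1; lia.
  by have := be _ j1; have := b_dec j1; lia.
split=> // [j jn|i i' j ii' i'n /andP[h4 h5] /andP[h6 h7]].
  by rewrite h2 //=; have := h1 _ jn; lia.
have i1 : (i.+1 < n)%N by lia.
have := h1 i (ltnW i1); rewrite i1.
by have := @decreasing_on_le e i.+1 i' de ii' i'n; lia.
Qed.

(** Induction on the number of letters. Column operations and multilinearity leave one determinant
    for every [e'] interlacing with [e]; those for [e'] not containing [b] have to vanish. *)
Lemma skew_det r e : (r <= K)%N -> decreasing_on e ->
  (forall i, (i < n)%N -> (e i + n <= N)%N) ->
  (forall i, (i < n)%N -> (b i <= e i)%N) ->
  fsum rk pred0 (fun _ => zz) r (cells n b e) =
  \det (\matrix_(i < n, j < n)
     ('X^(b i + (n - i.+1)) * \prod_(a < r) geom N (zz a))`_(e j + (n - j.+1))).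
Proof.
elim: r e => [|r IH] e rK de eN be.
  (* Without letters the entries compare shifted parts, and [b j <= b i <= e i] for [i < j] makes
     the transposed matrix triangular. *)
  rewrite fsum0 -det_tr.
  have trig (i j : 'I_n) : ~~ ((i < j) && (e i + (n - i.+1) == b j + (n - j.+1)))%N.
    apply/negP => /andP[ij /eqP]; have := be _ (ltn_ord i).
    have := @decreasing_on_le b i j b_dec (ltnW ij) (ltn_ord j).
    by have := ltn_ord j; lia.
  rewrite det_trig; last first.
    apply/is_trig_mxP => i j ij; rewrite !mxE big_ord0 mulr1 coefXn.
    by have := trig i j; rewrite ij /= => /negPf ->.
  case: (pselect (forall i : 'I_n, e i = b i)) => [H|/existsNP[i Hi]].
    rewrite big1 => [|i _]; last by rewrite !mxE big_ord0 mulr1 coefXn H eqxx.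
    case E : (cells n b e) => [//|[i j] s]; have : (i, j) \in cells n b e.
      by rewrite E mem_head.
    by rewrite mem_cells => /and3P[im bj]; rewrite (H (Ordinal im)) /=; lia.
  rewrite (bigD1 i) //= !mxE big_ord0 mulr1 coefXn eqn_add2r.
  have /negPf -> : e i != b i by apply/eqP.
  rewrite mul0r; case E : (cells n b e) => //.
  have : (i : nat, b i) \in cells n b e.
    by rewrite mem_cells ltn_ord leqnn /=; have := be _ (ltn_ord i); move/eqP: Hi; lia.
  by rewrite E.
have [a ra] := rk_onto rK.
have eN' i : (i < n)%N -> (e i < N)%N by move=> im; have := eN _ im; lia.
rewrite (fsum_step pred0 rk_inj ra be eN').
pose f (i : nat) := 'X^(b i + (n - i.+1)) * \prod_(a < r) geom N (zz a).
pose g (i : 'I_n) (j : nat) := (f i * geom N (zz r))`_(e j + (n - j.+1)).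
pose c (j : nat) := zz r ^+ (e j + (n - j.+1) - (e j.+1 + (n - j.+2))).
pose lo (j : nat) := if (j.+1 < n)%N then e j.+1 else 0%N.
have -> : \matrix_(i < n, j < n)
     ('X^(b i + (n - i.+1)) * \prod_(a < r.+1) geom N (zz a))`_(e j + (n - j.+1)) =
     \matrix_(i < n, j < n) g i j.
  by apply/matrixP => i j; rewrite !mxE big_ord_recr /= mulrA.
rewrite -(det_col_add_next g c).
have -> : \matrix_(i < n, j < n)
     (g i j - (if (j.+1 < n)%N then c j * g i j.+1 else 0)) =
  \matrix_(i < n, j < n) \sum_(q < N)
    ((lo j <= q < (e j).+1)%:R * zz r ^+ (e j - q)) * (f i)`_(q + (n - j.+1)).
  apply/matrixP => i j; rewrite !mxE; have jn := ltn_ord j; have ej := eN _ jn.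
  under [RHS]eq_bigr => q _ do rewrite -mulrA.
  rewrite -(@sum_nat_ord _ _ _ (fun q => _ ^+ (e j - q) * (f i)`_(q + (n - j.+1))));
    last by have := eN' _ jn.
  rewrite /lo; case: ifP => j1.
    have d1 := de _ j1.
    rewrite coef_mul_geomB; try lia.
    rewrite (_ : (e j.+1 + (n - j.+2)).+1 = e j.+1 + (n - j.+1))%N; last lia.
    rewrite (_ : (e j + (n - j.+1)).+1 = (e j).+1 + (n - j.+1))%N; last lia.
    rewrite big_addn addnK; apply: eq_big_nat => q hq.
    by rewrite mulrC; congr (_ ^+ _ * _); lia.
  rewrite subr0 (_ : n - j.+1 = 0)%N; last lia.
  rewrite /g coef_mul_geom; last lia.
  rewrite (_ : n - j.+1 = 0)%N ?addn0; last lia.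
  by apply: eq_bigr => q _; rewrite addn0 mulrC.
rewrite (det_sum_cols (fun j (q : 'I_N) => (lo j <= q < (e j).+1)%:R * zz r ^+ (e j - q))
  (fun i j (q : 'I_N) => (f i)`_(q + (n - j.+1)))) big_mkcond.
apply: eq_bigr => e' _ /=; rewrite prod_indicator.
have -> : \prod_(i < n) \prod_(e' i <= j < e i) zz r =
          \prod_(j < n) zz r ^+ (e j - e' j).
  by apply: eq_bigr => j _; rewrite prodr_const_nat.
case: asboolP => [/(skew_step _ _ de be)[h1 h2]|nst]; last first.
  case: forallP => h1; last by rewrite mul0r mul0r.
  (* Some row [k] of [e'] ends before [b k]. Then the rows up to [k] have lowest exponents beyond
     the positions read in the columns from [k] on, a zero block. *)
  have /existsNP[k] : ~ (forall j : 'I_n, (b j <= e' j)%N).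
    move=> h2; apply: nst; apply/(skew_step _ _ de be); split=> j jn.
      by have := h1 (Ordinal jn); rewrite -[j in ext _ j]/(val (Ordinal jn)) extE /lo /=.
    by have := h2 (Ordinal jn); rewrite -[j in ext _ j]/(val (Ordinal jn)) extE.
  move=> /negP; rewrite -ltnNge => bk; rewrite (@det_zero_block _ _ _ k) ?mulr0 //.
  move=> i j ik kj; rewrite !mxE coefXnM ifT //.
  have := @decreasing_on_le b i k b_dec ik (ltn_ord k).
  have : (e' j <= e' k)%N.
    move: kj; rewrite leq_eqVlt => /orP[/eqP/val_inj -> //|kj].
    have k1 : (k.+1 < n)%N by apply: leq_ltn_trans kj (ltn_ord j).
    have /andP[_ hj] := h1 j; have := h1 k; rewrite /lo k1 => /andP[hk _].
    have h := @decreasing_on_le e k.+1 j de kj (ltn_ord j).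
    rewrite ltnS in hj; exact: leq_trans (leq_trans hj h) hk.
  move=> ejk bik; rewrite -addSn; apply: leq_add; last by apply: leq_sub2l; rewrite ltnS (leq_trans ik).
  exact: leq_ltn_trans ejk (leq_trans bk bik).
have -> : [forall j : 'I_n, (lo j <= e' j < (e j).+1)%N].
  by apply/forallP => j; have := h1 j (ltn_ord j); rewrite extE.
rewrite mul1r IH //; first 1 last.
- by apply: ltnW.
- move=> j j1; have := h1 j (ltnW j1); rewrite j1; have := h1 _ j1; lia.
- by move=> j jn; have := h1 _ jn; have := eN _ jn; lia.
by congr (_ * \det _); apply/matrixP => i j; rewrite !mxE extE.
Qed.

End Skew.
End Determinants.

(** * Shifted fillings with a prescribed main diagonal *)

Lemma sum_shift (V : nmodType) j p m (F : nat -> V) :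
  \sum_(p <= t < m) F t = \sum_(p + j <= t < m + j) F (t - j)%N.
Proof. by rewrite big_addn addnK; apply: eq_bigr => t _; rewrite addnK. Qed.

Section Shifted.
Variable R : comNzRingType.
Variables (A : finType) (rk : A -> nat) (M : nat).
Hypothesis rk_inj : injective rk.
Hypothesis rk_onto : forall r, (r < M.*2)%N -> exists a, rk a = r.
Variables (zz ww cc : nat -> R) (n N : nat) (d : nat -> nat).
Hypothesis d_incr : forall i j, (i < j)%N -> (j < n)%N -> (d i < d j)%N.

(* Primed letters have even rank. *)
Definition even_rank (r : nat) := ~~ odd r.

(* The factor that vanishes unless row i starts with the symbol d_i encodes the
   prescribed main diagonal in the weight. *)
Definition fixed_diag_wt (c : nat * nat) (r : nat) : R :=
  if c.1 == c.2 then (r == (d c.1).*2.+1)%:R * cc (d c.1)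
  else if odd r then zz r./2 else ww r./2.

(* Generating function, by length, of row i filled with letters of rank below r. *)
Fixpoint row_poly (r i : nat) : {poly R} :=
  if r is r'.+1 then
    if odd r' then
      (row_poly r' i + ((r' == (d i).*2.+1)%:R * cc (d i)) *: 'X) * geom N (zz r'./2)
    else row_poly r' i * (1 + ww r'./2 *: 'X)
  else 0.

(* A row that has not started yet is matched with its own index, so that the
   matrix keeps the size n while rows appear one after the other. *)
Definition row_entry (r i j e : nat) : R :=
  if (e <= j)%N then ((r <= (d i).*2.+1)%N && (i == j))%:R
  else (row_poly r i)`_(e - j).

(** Row [j] starts in column [j], so weakly decreasing ends mean strictly decreasing lengths. Empty
    rows come last. *)
Definition shifted_on (e : nat -> nat) : Prop :=
  (forall j, (j < n)%N -> (j <= e j)%N) /\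
  (forall j, (j.+1 < n)%N -> (j.+1 < e j.+1)%N -> (e j.+1 <= e j)%N).

Lemma shifted_on_le e i j : shifted_on e -> (i <= j)%N -> (j < n)%N ->
  (j < e j)%N -> (e j <= e i)%N.
Proof.
move=> [_ he]; elim: j => [|j IH]; first by rewrite leqn0 => /eqP ->.
rewrite leq_eqVlt => /orP[/eqP -> //|ij] jn ej.
have h := he j jn ej; apply: (leq_trans h).
apply: IH; [exact: ij | exact: ltnW | exact: leq_trans (ltnW ej) h].
Qed.

Lemma row_poly_unborn r i : (r <= (d i).*2.+1)%N -> row_poly r i = 0.
Proof.
elim: r => //= r IH rd; rewrite IH ?(ltnW rd) // ?mul0r.
by rewrite (ltn_eqF rd) mul0r scale0r addr0 mul0r if_same.
Qed.

Lemma row_poly_coef0 r i : (row_poly r i)`_0 = 0.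
Proof.
elim: r => [|r IH] /=; first by rewrite coef0.
by case: ifP => _; rewrite coef0M ?coefD ?coefZ ?coefX IH ?mulr0 ?addr0 mul0r.
Qed.

(** A row is empty until its unprimed diagonal letter, so a primed [d i] comes too early. Each later
    symbol contributes at most one primed letter and any number of unprimed ones. *)
Lemma row_polyE i : (d i < M)%N ->
  row_poly M.*2 i = (cc (d i) *: 'X) * geom N (zz (d i)) *
    \prod_((d i).+1 <= a < M) ((1 + ww a *: 'X) * geom N (zz a)).
Proof.
elim: M => // m IH; rewrite doubleS /= odd_double /= ltnS leq_eqVlt.
rewrite uphalf_double doubleK eqSS.
case: eqVneq => [<- _|ne /= lt].
  rewrite row_poly_unborn ?leqnSn // mul0r add0r eqxx mul1r.
  by rewrite big_geq // mulr1.
rewrite IH // big_nat_recr //= (inj_eq double_inj) eq_sym (negPf ne) mul0r scale0r addr0.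
by rewrite !mulrA.
Qed.

(** A nonempty row whose diagonal letter is not yet available kills both sides: the diagonal cell
    has weight 0 here, and row [j] of the matrix is zero in [det_unborn]. *)
Lemma fsum_unborn r e j : (j < n)%N -> (j < e j)%N -> (r <= (d j).*2.+1)%N ->
  fsum rk even_rank fixed_diag_wt r (cells n id e) = 0.
Proof.
move=> jn je rd; rewrite /fsum big1 // => P /andP[_ /forallP H].
have hc : (j, j) \in cells n id e by rewrite mem_cells jn leqnn.
rewrite (bigD1 (SeqSub hc)) //= /fixed_diag_wt /= eqxx.
have := H (SeqSub hc); case: eqP => [->|_ _]; last by rewrite !mul0r.
lia.
Qed.

Lemma det_unborn r e j : (j < n)%N -> (j < e j)%N -> (r <= (d j).*2.+1)%N ->
  \det (\matrix_(i < n, k < n) row_entry r i k (e k)) = 0.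
Proof.
move=> jn je rd; apply: (@det_row0 _ _ _ (Ordinal jn)) => k; rewrite mxE /row_entry /=.
rewrite row_poly_unborn // coef0; case: ifP => // ek.
by case: eqP => [e1|]; rewrite ?andbF //; move: ek je; rewrite e1; lia.
Qed.

Lemma step_shifted r e' e : shifted_on e -> step even_rank n id r e' e -> shifted_on e'.
Proof.
move=> [h1 h2] [s1 s2 s3]; split=> [j /s1/andP[] //|j jn je].
have := s1 _ jn; have jn' := ltnW jn; have := s1 _ jn' => b1 b2.
have e1 : (e j.+1 <= e j)%N by apply: h2 => //; lia.
rewrite leqNgt; apply/negP => lt.
have [||_] := s3 j j.+1 (e' j.+1).-1 (ltnSn j) jn; lia.
Qed.

Section DetStep.
Variables (r : nat) (e : nat -> nat).
Hypotheses (rM : (r < M.*2)%N) (e_sh : shifted_on e).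
Hypothesis (e_born : forall j, (j < n)%N -> (j < e j)%N = ((d j).*2.+1 <= r)%N).
Hypothesis (eN : forall j, (j < n)%N -> (e j < N)%N).

(** The least end of row [j] after the letter of rank [r] is removed: a primed letter takes at most
    one cell, an unprimed one only cells with no cell of the next row below. *)
Definition next_end (j : nat) : nat :=
  if even_rank r then maxn j (e j).-1
  else if (j.+1 < n)%N && (j.+1 < e j.+1)%N then e j.+1 else j.

(** Apart from the shiftedness of [e'], the conditions become one interval per row, which is what an
    expansion by columns can express. *)
Lemma step_next_end e' : step even_rank n id r e' e <->
  shifted_on e' /\ forall j, (j < n)%N -> (next_end j <= e' j <= e j)%N.
Proof.
split=> [st|[[g1 g2] H]].
  split; first exact: step_shifted st.
  case: st => s1 s2 s3 j jn; have b1 := s1 _ jn; rewrite /next_end.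
  case: ifP => er.
    by have := s2 _ er jn; rewrite geq_max; lia.
  case: ifP => [/andP[j1 je]|_]; last lia.
  have e1 : (e j.+1 <= e j)%N by case: e_sh => _ h; apply: h.
  apply/andP; split; last lia.
  rewrite leqNgt; apply/negP => lt.
  have h4 : (e' j <= (e j.+1).-1 < e j)%N by lia.
  have h5 : (id j.+1 <= (e j.+1).-1 < e j.+1)%N by rewrite /=; lia.
  by have [] := s3 _ _ _ (ltnSn j) j1 h4 h5; rewrite er.
have Hle i j : (i < j)%N -> (j < n)%N -> (j < e' j)%N -> (e' j <= e' i)%N.
  by move=> ij jn je; apply: shifted_on_le => //; apply: ltnW.
split=> [i im|i er im|i i' j ii' im h h'].
- by have := g1 _ im; have := H _ im; lia.
- by have := H _ im; rewrite /next_end er geq_max; lia.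
have im' : (i < n)%N by lia.
have := H _ im'; rewrite /next_end; case: ifP => er h2.
  split=> //; case: (leqP (e' i') i') => [|lt]; first lia.
  by have := Hle _ _ ii' im lt; lia.
have h3 := @shifted_on_le e i.+1 i' e_sh ii' im.
have i'e : (i' < e i')%N by lia.
have := h3 i'e => h4; exfalso.
have hh : (i.+1 < n)%N && (i.+1 < e i.+1)%N by lia.
by move: h2; rewrite hh; lia.
Qed.

Let coeff (j q : nat) : R :=
  (next_end j <= q < (e j).+1)%:R * \prod_(q <= t < e j) fixed_diag_wt (j, t) r.

Lemma wt_above j q : (j < q)%N ->
  \prod_(q <= t < e j) fixed_diag_wt (j, t) r =
  (if odd r then zz r./2 else ww r./2) ^+ (e j - q).
Proof.
move=> jq; rewrite -prodr_const_nat; apply: eq_big_nat => t ht.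
by rewrite /fixed_diag_wt /= ltn_eqF //; lia.
Qed.

Lemma wt_diag j : (j < e j)%N ->
  \prod_(j <= t < e j) fixed_diag_wt (j, t) r =
  (r == (d j).*2.+1)%:R * cc (d j) *
  (if odd r then zz r./2 else ww r./2) ^+ (e j - j.+1).
Proof.
by move=> je; rewrite big_ltn // wt_above // /fixed_diag_wt /= eqxx.
Qed.

(** For a primed letter the factor [1 + w t] gives two terms per column. For an unprimed one a
    multiple of the next column is subtracted first. *)
Lemma det_expand :
  \det (\matrix_(i < n, j < n) row_entry r.+1 i j (e j)) =
  \det (\matrix_(i < n, j < n) \sum_(q < N) coeff j q * row_entry r i j q).
Proof.
have [eg1 eg2] := e_sh.
have sumE (i j : nat) : (j < n)%N -> \sum_(q < N) coeff j q * row_entry r i j q =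
    \sum_(next_end j <= q < (e j).+1)
       (\prod_(q <= t < e j) fixed_diag_wt (j, t) r) * row_entry r i j q.
  move=> jn; rewrite (sum_nat_ord _ _ (eN jn)).
  by apply: eq_bigr => q _; rewrite mulrA.
case er: (even_rank r).
  congr (\det _); apply/matrixP => i j; rewrite !mxE sumE // /next_end er.
  have odr : odd r = false by apply/negbTE.
  have jn := ltn_ord j; have gj := eg1 _ jn.
  case: (ltnP j (e j)) => je; last first.
    have -> : e j = j by apply/eqP; rewrite eqn_leq je gj.
    rewrite (_ : maxn j j.-1 = j); last lia.
    rewrite big_nat1 big_geq // mul1r /row_entry leqnn.
    by rewrite ltn_neqAle (_ : r != _) //; apply/eqP => rr; move: odr; rewrite rr /= odd_double.
  have dn : (r == (d j).*2.+1) = false.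
    by apply/negP => /eqP rr; move: odr; rewrite rr /= odd_double.
  rewrite (_ : maxn j (e j).-1 = (e j).-1); last lia.
  rewrite big_nat_recr /=; last lia.
  rewrite -[X in \sum_(_ <= _ < X) _](prednK (n := e j)); last lia.
  rewrite big_nat1 /= [X in _ + X * _]big_geq // mul1r.
  rewrite /row_entry (leqNgt (e j) j) je /= odr mulrDr mulr1 coefD addrC; congr (_ + _).
  rewrite -scalerAr coefZ coefMX.
  rewrite ifF; last lia.
  case: (ltnP j (e j).-1) => h /=.
    rewrite wt_above // odr (_ : e j - (e j).-1 = 1)%N ?expr1; last lia.
    by rewrite (_ : (e j - j).-1 = (e j).-1 - j)%N //; lia.
  (* The row has a single cell, on the diagonal, where a primed letter has weight 0. *)
  rewrite (_ : (e j - j).-1 = 0)%N ?row_poly_coef0 ?mulr0; last lia.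
  by rewrite (_ : (e j).-1 = j) ?wt_diag ?dn ?mul0r //; lia.
have odr : odd r by apply/negbFE.
pose g (i : 'I_n) (j : nat) := row_entry r.+1 i j (e j).
(* Column [j + 1] consists of coefficients only if row [j + 1] is nonempty; otherwise it is a
   placeholder and nothing is subtracted. *)
pose c (j : nat) := if (j.+1 < e j.+1)%N then
   zz r./2 ^+ ((e j - j) - (e j.+1 - j.+1)) else 0.
transitivity (\det (\matrix_(i < n, j < n) g i j)); first by [].
rewrite -(det_col_add_next g c).
congr (\det _); apply/matrixP => i j; rewrite !mxE sumE //.
have jn := ltn_ord j; have gj := eg1 _ jn.
rewrite /next_end er /g /c /row_entry /= odr.
case: (ltnP j (e j)) => je; last first.
  have eij : e j = j by apply/eqP; rewrite eqn_leq je gj.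
  have dr := e_born jn; rewrite eij ltnn in dr.
  have -> : (j.+1 < n)%N && (j.+1 < e j.+1)%N = false.
    by apply/negP => /andP[j1 je1]; have := eg2 _ j1 je1; lia.
  have -> : (if (j.+1 < n)%N then
     (if (j.+1 < e j.+1)%N then zz r./2 ^+ (e j - j - (e j.+1 - j.+1)) else 0) *
        (if (e j.+1 <= j.+1)%N then ((r < (d i).*2.+1)%N && (i == j.+1 :> nat))%:R
         else ((row_poly r i + ((r == (d i).*2.+1)%:R * cc (d i)) *: 'X) *
               geom N (zz r./2))`_(e j.+1 - j.+1)) else 0) = 0 :> R.
    case: ifP => // j1; case: ifP => je1; last by rewrite mul0r.
    by have := eg2 _ j1 je1; lia.
  rewrite eij big_nat1 big_geq // mul1r leqnn subr0.
  case: eqP => [->|_]; last by rewrite !andbF.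
  by rewrite !andbT; congr (_ %:R); lia.
case j1e : ((j.+1 < n)%N && (j.+1 < e j.+1)%N).
  have /andP[j1 je1] := j1e; rewrite j1 je1.
  have h := eg2 _ j1 je1; rewrite (leqNgt (e j.+1)) je1 /= coef_mul_geomB; last 2 first.
  - lia.
  - by apply: leq_ltn_trans (leq_subr _ _) (eN jn).
  rewrite (_ : (e j.+1 - j.+1).+1 = e j.+1 - j)%N; last lia.
  rewrite (_ : (e j - j).+1 = (e j).+1 - j)%N; last lia.
  rewrite (sum_shift j) subnK; last lia.
  rewrite subnK; last lia.
  apply: eq_big_nat => t ht.
  rewrite ifF; last lia.
  rewrite wt_above ?odr; last lia.
  rewrite coefD coefZ coefX (_ : (t - j == 1)%N = false) ?mulr0 ?addr0; last lia.
  by rewrite mulrC; congr (_ ^+ _ * _); lia.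
have -> : (if (j.+1 < n)%N then
     (if (j.+1 < e j.+1)%N then zz r./2 ^+ (e j - j - (e j.+1 - j.+1)) else 0) *
        (if (e j.+1 <= j.+1)%N then ((r < (d i).*2.+1)%N && (i == j.+1 :> nat))%:R
         else ((row_poly r i + ((r == (d i).*2.+1)%:R * cc (d i)) *: 'X) *
               geom N (zz r./2))`_(e j.+1 - j.+1)) else 0) = 0 :> R.
  by case: ifP j1e => //= _ ->; rewrite mul0r.
rewrite subr0 coef_mul_geom; last by apply: leq_ltn_trans (leq_subr _ _) (eN jn).
rewrite [LHS]big_ltn // coefD row_poly_coef0 coefZ coefX /= mulr0 addr0 mul0r add0r.
rewrite [RHS]big_ltn; last lia.
rewrite leqnn wt_diag // odr.
(* The term [q = j] turns the placeholder into the first cell of the row. If [r] is the diagonal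
   letter of row [i], then [i = j]: by [e_born], row [j] nonempty gives [d j <= d i], while an
   existing but empty row [j + 1] gives [d i < d j.+1]. *)
have -> : (r == (d j).*2.+1)%:R * cc (d j) * zz r./2 ^+ (e j - j.+1) *
   ((r <= (d i).*2.+1)%N && (i == j :> nat))%:R =
   (r == (d i).*2.+1)%:R * cc (d i) * zz r./2 ^+ (e j - j.+1) :> R.
  case: (eqVneq (i : nat) j) => [->|ij]; rewrite ?andbF ?andbT.
    by case: eqP => [->|_]; rewrite ?leqnn ?mulr1 // !mul0r.
  suff -> : (r == (d i).*2.+1) = false by rewrite mulr0 !mul0r.
  apply/negP => /eqP ri; have := e_born jn; rewrite je ri => /esym dji.
  have ji : (j <= i)%N.
    by rewrite leqNgt; apply/negP => /d_incr/(_ jn); lia.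
  have j1n : (j.+1 < n)%N by have := ltn_ord i; move/eqP: ij; lia.
  move: j1e; rewrite j1n /= => /negbT; rewrite e_born // ri.
  have [-> |lt] := eqVneq (i : nat) j.+1; first by rewrite leqnn.
  have : (d j.+1 < d i)%N by apply: d_incr => //; move/eqP: ij; move/eqP: lt; lia.
  by lia.
have -> : \sum_(1 <= t < (e j - j).+1)
     (row_poly r i + ((r == (d i).*2.+1)%:R * cc (d i)) *: 'X)`_t *
     zz r./2 ^+ (e j - j - t) =
   (r == (d i).*2.+1)%:R * cc (d i) * zz r./2 ^+ (e j - j.+1) +
   \sum_(1 <= t < (e j - j).+1) (row_poly r i)`_t * zz r./2 ^+ (e j - j - t).
  rewrite !(@big_ltn _ _ _ 1) ?ltnS ?subn_gt0 // coefD coefZ coefX /= mulr1 mulrDl.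
  rewrite [X in X + _]addrC -addrA; congr (_ + (_ + _)).
    by rewrite (_ : e j - j - 1 = e j - j.+1)%N //; lia.
  apply: eq_big_nat => t ht.
  by rewrite coefD coefZ coefX (_ : (t == 1)%N = false) ?mulr0 ?addr0 //; lia.
congr (_ + _); rewrite (sum_shift j) add1n addSn subnK; last lia.
apply: eq_big_nat => t ht.
rewrite ifF; last lia.
by rewrite wt_above ?odr; [rewrite mulrC; congr (_ ^+ _ * _); lia | lia].
Qed.

(** Only a primed letter can break the shifted shape, by shortening row [j] while row [j + 1] keeps
    the same former end. Columns [j] and [j + 1] then read the same coefficients. *)
Lemma next_end_shifted e' :
  (forall j, (j < n)%N -> (next_end j <= e' j <= e j)%N) ->
  shifted_on e' \/ exists2 j, (j.+1 < n)%N &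
     (j < e' j)%N /\ (e' j).+1 = e' j.+1.
Proof.
have [eg1 eg2] := e_sh.
move=> H; have g1 j : (j < n)%N -> (j <= e' j)%N.
  move=> jn; have := H _ jn; rewrite /next_end; have := eg1 _ jn.
  case: ifP => _; first by rewrite geq_max; lia.
  by case: ifP => [/andP[j1 je]|_]; [have := eg2 _ j1 je; lia | lia].
case: (pselect (shifted_on e')) => [|nsh]; first by left.
right; apply: contrapT => H2; apply: nsh; split=> // j j1 je.
rewrite leqNgt; apply/negP => lt; apply: H2; exists j => //.
have := H _ j1; have := H _ (ltnW j1); have e1 := eg2 _ j1.
rewrite /next_end; case: ifP => er; first by rewrite !geq_max; have := g1 _ j1; lia.
move=> h1 h2; have hh : (j.+1 < n)%N && (j.+1 < e j.+1)%N by lia.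
by move: h1; rewrite hh; lia.
Qed.

Lemma det_step :
  \det (\matrix_(i < n, j < n) row_entry r.+1 i j (e j)) =
  \sum_(e' : {ffun 'I_n -> 'I_N} | `[< step even_rank n id r (ext e') e >])
    (\prod_(i < n) \prod_(e' i <= j < e i) fixed_diag_wt (i : nat, j) r) *
    \det (\matrix_(i < n, j < n) row_entry r i j (ext e' j)).
Proof.
rewrite det_expand (det_sum_cols (fun j (q : 'I_N) => coeff j q)
  (fun i j (q : 'I_N) => row_entry r i j q)) [RHS]big_mkcond.
apply: eq_bigr => e' _; rewrite prod_indicator.
have extM : \matrix_(i < n, j < n) row_entry r i j (ext e' j) =
            \matrix_(i < n, j < n) row_entry r i j (e' j).
  by apply/matrixP => i j; rewrite !mxE extE.
rewrite extM; case: asboolP => [/step_next_end[_ H]|nst].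
  have -> : [forall j : 'I_n, (next_end j <= e' j < (e j).+1)%N].
    by apply/forallP => j; have := H _ (ltn_ord j); rewrite extE.
  by rewrite mul1r.
case: forallP => H; last by rewrite !mul0r.
have H' j : (j < n)%N -> (next_end j <= ext e' j <= e j)%N.
  by move=> jn; have := H (Ordinal jn); rewrite -[j in ext _ j]/(val (Ordinal jn)) extE.
case: (next_end_shifted H') => [sh|[j j1 [je e1]]].
  by case: nst; apply/step_next_end.
have jn := ltnW j1; pose k := Ordinal jn; pose k1 := Ordinal j1.
rewrite (@det_eq_cols _ _ _ k k1) ?mulr0 //.
  by rewrite -val_eqE /= neq_ltn ltnSn.
move=> i; rewrite !mxE /row_entry -(extE e' k) -(extE e' k1) /= -e1.
rewrite subSS ifF; last lia.
by rewrite ifF //; lia.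
Qed.

End DetStep.

Lemma shifted_det r e : (r <= M.*2)%N -> shifted_on e ->
  (forall j, (j < n)%N -> (d j).*2.+1 < r -> j < e j)%N ->
  (forall j, (j < n)%N -> (e j < N)%N) ->
  fsum rk even_rank fixed_diag_wt r (cells n id e) =
  \det (\matrix_(i < n, j < n) row_entry r i j (e j)).
Proof.
elim: r e => [|r IH] e rM e_sh eb eN.
  case: (pselect (exists2 j, (j < n)%N & (j < e j)%N)) => [[j jn je]|H].
    by rewrite (fsum_unborn (j := j)) // (det_unborn (j := j)).
  have ee j : (j < n)%N -> e j = j.
    move=> jn; apply/eqP; rewrite eqn_leq (proj1 e_sh _ jn) andbT leqNgt.
    by apply/negP => je; apply: H; exists j.
  rewrite fsum0.
  have -> : cells n id e = [::].
    case E : (cells n id e) => [//|[i j] s].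
    have : (i, j) \in cells n id e by rewrite E mem_head.
    by rewrite mem_cells => /and3P[im]; rewrite ee //=; lia.
  suff -> : \matrix_(i < n, j < n) row_entry 0 i j (e j) = 1%:M :> 'M[R]_n.
    by rewrite det1.
  by apply/matrixP => i j; rewrite !mxE /row_entry ee // leqnn.
case: (pselect (exists2 j, (j < n)%N & (j < e j)%N && (r < (d j).*2.+1)%N)).
  by move=> [j jn /andP[je dj]]; rewrite (fsum_unborn (j := j)) // (det_unborn (j := j)).
move=> H; have e_born j : (j < n)%N -> (j < e j)%N = ((d j).*2.+1 <= r)%N.
  move=> jn; apply/idP/idP => [je|dr]; last exact: eb.
  by rewrite leqNgt; apply/negP => dr; apply: H; exists j; rewrite // je.
have [a ra] := rk_onto rM.
have be i : (i < n)%N -> (id i <= e i)%N by move=> im; exact: (proj1 e_sh).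
rewrite (fsum_step even_rank rk_inj ra be eN) det_step //.
apply: eq_bigr => e' /asboolP st; have [sh H'] := proj1 (step_next_end rM e_sh (ext e')) st.
case: (pselect (forall j, (j < n)%N -> (d j).*2.+1 < r -> j < ext e' j)%N) => [b'|].
  congr (_ * _); apply: IH => //; first exact: ltnW.
  move=> j jn; have [s1 _ _] := st; have /andP[_ h] := s1 _ jn.
  exact: leq_ltn_trans h (eN _ jn).
(* Here [e'] empties a row whose diagonal letter has rank below [r]. The diagonal cell would carry
   rank [r], so the weight is 0. *)
move=> /existsNP[j /not_implyP[jn /not_implyP[dr /negP]]]; rewrite -leqNgt => h.
have ej : ext e' j = j by apply/eqP; rewrite eqn_leq h (proj1 sh).
rewrite (bigD1 (Ordinal jn)) //= -(extE e' (Ordinal jn)) /= ej wt_diag; last first.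
  by rewrite e_born // ltnW.
- exact: rM.
have -> : (r == (d j).*2.+1)%N = false by apply/negP => /eqP rr; rewrite rr ltnn in dr.
by rewrite !mul0r.
Qed.
End Shifted.

(** * Sequences without antipodal pairs *)

Definition incr_on (n : nat) (p : nat -> nat) : Prop :=
  forall i j, (i < j)%N -> (j < n)%N -> (p i < p j)%N.

(** The case [i = j] is included and excludes the value [n]. *)
Definition antipode_free (n : nat) (p : nat -> nat) : Prop :=
  forall i j, (i < n)%N -> (j < n)%N -> (p i + p j)%N <> n.*2.

Lemma incr_on_inj n p i j : incr_on n p -> (i < n)%N -> (j < n)%N ->
  p i = p j -> i = j.
Proof.
move=> pi im jn e; case: (ltngtP i j) => // [/pi/(_ jn)|/pi/(_ im)]; rewrite e ltnn //.
Qed.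

(** Folding [2n - k] onto [k] is injective on the values of [p]; these are [n] in number, so every
    [k < n] is hit. *)
Lemma antipode_free_hits n p k : incr_on n p ->
  (forall j, (j < n)%N -> (p j <= n.*2)%N) -> antipode_free n p -> (k < n)%N ->
  exists2 j, (j < n)%N & p j = k \/ p j = (n.*2 - k)%N.
Proof.
move=> pincr pn pfree kn.
have hlt (j : 'I_n) : ((if p j < n then p j else n.*2 - p j) < n)%N.
  case: (ltnP (p j) n) => // h; have h1 := pfree j j (ltn_ord j) (ltn_ord j).
  have h2 := pn _ (ltn_ord j); lia.
have hinj : injective (fun j : 'I_n => Ordinal (hlt j)).
  move=> i j /(congr1 val) /= e; apply/val_inj => /=.
  apply: (incr_on_inj pincr (ltn_ord i) (ltn_ord j)).
  have := pfree i j (ltn_ord i) (ltn_ord j).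
  have := pn _ (ltn_ord j); have := pn _ (ltn_ord i); move: e.
  by case: ltnP => h1; case: ltnP => h2; lia.
have /codomP[j /(congr1 val) /= e] := injF_onto hinj (Ordinal kn).
exists j; first exact: ltn_ord.
by move: e; case: ifP => _ e; [left | right; have := pn _ (ltn_ord j); lia].
Qed.

Section Antipode.
Variable R : comNzRingType.

(* Cofactor expansion along row 0 removes the entry equal to 0, in the first
   column, or the one equal to 2n, in the last column; the sign in the second
   case is the one of the cofactor. *)
Definition antipode_coef (n k q : nat) : R :=
  (q == k)%:R + (-1) ^+ (n - k.+1) * (q == n.*2 - k)%N%:R.

Lemma det_scale_cols n (c : 'I_n -> R) (f : 'I_n -> 'I_n -> R) :
  \det (\matrix_(i, j) (c j * f i j)) = (\prod_j c j) * \det (\matrix_(i, j) f i j).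
Proof.
rewrite !det_col_form big_distrr /=; apply: eq_bigr => s _.
rewrite mulrCA; congr (_ * _); rewrite -big_split /=.
by apply: eq_bigr => j _; rewrite !mxE.
Qed.

Lemma det_prop_cols n (A : 'M[R]_n) j1 j2 c : j1 != j2 ->
  (forall i, A i j2 = c * A i j1) -> \det A = 0.
Proof.
move=> ne Ac.
have -> : A = \matrix_(i, j) ((if j == j2 then c else 1) *
                              A i (if j == j2 then j1 else j)).
  by apply/matrixP => i j; rewrite mxE; case: eqP => [->|_]; rewrite ?mul1r.
rewrite det_scale_cols (@det_eq_cols _ _ _ j1 j2) ?mulr0 // => i.
by rewrite !mxE eqxx (negPf ne).
Qed.

(** Two distinct antipodal entries make two columns proportional, and the middle value gives a zero
    column. Otherwise 0 or [2n] occurs; it is removed and the other entries are lowered by 1. *)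
Lemma det_antipode n p : incr_on n p -> (forall j, (j < n)%N -> (p j <= n.*2)%N) ->
  \det (\matrix_(k < n, j < n) antipode_coef n k (p j)) =
  `[< antipode_free n p >]%:R.
Proof.
elim: n p => [|n IH] p pincr pn.
  by rewrite det_mx00; case: asboolP => // -[]; move=> i j.
case: asboolP => [pfree|]; last first.
  move=> /existsNP[i /existsNP[j /not_implyP[im /not_implyP[jn /contrapT e]]]].
  have main a b : (a < b)%N -> (b < n.+1)%N -> (p a + p b)%N = n.+1.*2 ->
      \det (\matrix_(k < n.+1, j < n.+1) antipode_coef n.+1 k (p j)) = 0.
    move=> ab bn s; have pab := pincr _ _ ab bn; have an := ltn_trans ab bn.
    apply: (@det_prop_cols _ _ (Ordinal an) (Ordinal bn)
             ((-1) ^+ (n.+1 - (p a).+1))).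
      by rewrite -val_eqE /= neq_ltn ab.
    move=> k; have kn := ltn_ord k; rewrite !mxE /antipode_coef /=.
    have -> : (p b == k) = false by apply/negP => /eqP; lia.
    have -> : (p a == n.+1.*2 - k)%N = false by apply/negP => /eqP; lia.
    rewrite add0r mulr0 addr0; case: (eqVneq (p a) k) => [e1|ne].
      have e2 : p b = (n.+1.*2 - p a)%N by lia.
      by rewrite -e1 -e2 eqxx.
    have -> : (p b == n.+1.*2 - k)%N = false by apply/negP => /eqP; lia.
    by rewrite !mulr0.
  case: (ltngtP i j) => ij; first exact: main ij jn e.
    by apply: main ij im _; rewrite addnC.
  apply: (@det_col0 _ _ _ (Ordinal im)) => k; have kn := ltn_ord k.
  rewrite !mxE /antipode_coef /=; move: e; rewrite -ij => e.
  have -> : (p i == k) = false by apply/negP => /eqP; lia.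
  have -> : (p i == n.+1.*2 - k)%N = false by apply/negP => /eqP; lia.
  by rewrite mulr0 addr0.
have [j jn [pj|pj]] := antipode_free_hits pincr pn pfree (ltn0Sn n).
  have j0 : j = 0%N by case: j jn pj => // j jn pj; have := pincr 0%N j.+1 isT jn; lia.
  subst j; rewrite (expand_det_col _ ord0) (bigD1 ord0) //= mxE /antipode_coef /= pj.
  rewrite eqxx /= mulr0 addr0 mul1r big1 ?addr0; last first.
    move=> k; rewrite -val_eqE /= => k0; have kn := ltn_ord k.
    rewrite mxE /antipode_coef /= pj.
    have -> : (0%N == k) = false by apply/negP => /eqP; lia.
    have -> : (0 == n.+1.*2 - k)%N = false by apply/negP => /eqP; lia.
    by rewrite mulr0 addr0 mul0r.
  rewrite /cofactor expr0 mul1r.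
  have p1 i : (i < n)%N -> (1 <= p i.+1 <= n.*2.+1)%N.
    move=> im; have h1 : (i.+1 < n.+1)%N by lia.
    by have := pincr 0%N i.+1 isT h1; have := pn _ h1;
       have := pfree 0%N i.+1 isT h1; rewrite pj doubleS; lia.
  rewrite -[LHS](_ : \det (\matrix_(k < n, j < n) antipode_coef n k (p j.+1).-1) = _).
    rewrite (IH (fun j => (p j.+1).-1)); first 1 last.
    - move=> i k ik kn; have := pincr i.+1 k.+1 ik kn.
      by have := p1 _ kn; have := p1 _ (ltn_trans ik kn); lia.
    - by move=> i im; have := p1 _ im; lia.
    case: asboolP => // -[] i k im kn.
    have := p1 _ kn; have := p1 _ im; have := pfree i.+1 k.+1 im kn.
    by rewrite doubleS; lia.
  congr (\det _); apply/matrixP => i k; rewrite !mxE /antipode_coef !lift0 subSS.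
  have := p1 _ (ltn_ord k); have := ltn_ord i => im pk.
  congr (_ %:R + _ * _ %:R); rewrite ?doubleS; apply/eqP/eqP; lia.
have jn' : j = n.
  move: jn; rewrite ltnS leq_eqVlt => /orP[/eqP //|lt].
  by have := pincr j n lt (ltnSn n); have := pn n (ltnSn n); lia.
subst j; rewrite (expand_det_col _ ord_max) (bigD1 ord0) //= mxE /antipode_coef /= pj.
rewrite subn0 eqxx mulr1 subn1 /= add0r big1 ?addr0; last first.
  move=> k; rewrite -val_eqE /= => k0; have kn := ltn_ord k.
  rewrite mxE /antipode_coef /= pj subn0.
  have -> : (n.+1.*2 == k) = false by apply/negP => /eqP; lia.
  have -> : (n.+1.*2 == n.+1.*2 - k)%N = false by apply/negP => /eqP; lia.
  by rewrite mulr0 addr0 mul0r.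
(* The sign in [antipode_coef] cancels that of the cofactor at the top right corner. *)
rewrite /cofactor add0n mulrA -exprD addnn -signr_odd odd_double expr0 mul1r.
have p1 i : (i < n)%N -> (1 <= p i <= n.*2.+1)%N.
  move=> im; have h1 : (i < n.+1)%N by lia.
  by have := pincr i n im (ltnSn n); have := pfree i n h1 (ltnSn n); rewrite pj doubleS; lia.
rewrite -[LHS](_ : \det (\matrix_(k < n, j < n) antipode_coef n k (p j).-1) = _).
  rewrite (IH (fun j => (p j).-1)); first 1 last.
  - move=> i k ik kn; have := pincr i k ik (leqW kn).
    by have := p1 _ kn; have := p1 _ (ltn_trans ik kn); lia.
  - by move=> i im; have := p1 _ im; lia.
  case: asboolP => // -[] i k im kn.
  have := p1 _ kn; have := p1 _ im; have := pfree i k (leqW im) (leqW kn).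
  by rewrite doubleS; lia.
congr (\det _); apply/matrixP => i k; rewrite !mxE /antipode_coef lift0 lift_max subSS.
have := p1 _ (ltn_ord k); have := ltn_ord i => im pk.
congr (_ %:R + _ * _ %:R); rewrite ?doubleS; apply/eqP/eqP; lia.
Qed.

End Antipode.

(** * Primed tableaux *)

Lemma symbol_rank_le n (a : symbol n) : (symbol_rank a <= n.*2)%N.
Proof. by case: a => [k||k] /=; try have := ltn_ord k; lia. Qed.

Lemma symbol_rank_inj n : injective (@symbol_rank n).
Proof.
move=> [k||k] [l||l] //= e; try have := ltn_ord k; try have := ltn_ord l; move=> *;
  try lia; by congr (_ _); apply: val_inj => /=; lia.
Qed.

Lemma rank_inj n : injective (@rank n).
Proof.
move=> [a b] [a' b']; rewrite /rank /primed /= => e.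
have eb : b = b' by case: b b' e => -[] //=; lia.
by congr (_, _) => //; apply: symbol_rank_inj; move: e; rewrite eb; lia.
Qed.

Lemma rank_onto n r : (r < n.*2.+1.*2)%N -> exists a : letter n, rank a = r.
Proof.
move=> rn; have [s es] : exists s : symbol n, symbol_rank s = r./2.
  case: (ltngtP r./2 n) => h; last by exists Zero.
    by exists (Plain (Ordinal h)).
  have h2 : (n.*2 - r./2 < n)%N by lia.
  by exists (Bar (Ordinal h2)) => /=; lia.
exists (s, ~~ odd r); rewrite /rank /primed /= es negbK -[RHS]odd_double_half addnC //.
Qed.

Lemma odd_rank n (a : letter n) : odd (rank a) = ~~ primed a.
Proof. by rewrite /rank oddD odd_double /= oddb. Qed.

Lemma half_rank n (a : letter n) : (rank a)./2 = symbol_rank a.1.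
Proof. by rewrite /rank addnC half_bit_double. Qed.

Definition has_label n (a : letter n) (k : 'I_n) : bool :=
  (a == (Plain k, false)) || (a == (Bar k, false)).

Lemma has_label_inj n (a : letter n) (k k' : 'I_n) :
  has_label a k -> has_label a k' -> k = k'.
Proof.
have kn := ltn_ord k; have kn' := ltn_ord k' => h h'.
apply: val_inj => /=; move: h h' => /orP[] /eqP -> /orP[] /eqP e;
  have /= := congr1 (fun a => symbol_rank a.1) e; lia.
Qed.

Section Weights.
Variables (F : fieldType) (n : nat) (x y : 'I_n -> F) (z0 : F).

Definition plain_wt (a : nat) : F := (zvec x y z0)`_a.
(** Priming exchanges the roles of [x] and [y] and inverts [z0], so the primed weights form a vector
    of the same shape. *)
Definition primed_wt (a : nat) : F := (zvec y x z0^-1)`_a.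
Definition diag_wt (a : nat) : F :=
  if insub a is Some k then wgt_diag x y z0 (Plain k, false) else 1.

Lemma nth_zvec (u v : 'I_n -> F) t (s : symbol n) :
  (zvec u v t)`_(symbol_rank s) =
  match s with Plain k => u k | Zero => t | Bar k => (v k)^-1 end.
Proof.
have sz (w : 'I_n -> F) : size (codom w) = n by rewrite size_codom card_ord.
have nthc (w : 'I_n -> F) (k : 'I_n) : (codom w)`_k = w k.
  rewrite codomE (nth_map k) ?size_enum_ord //.
  by rewrite nth_ord_enum.
rewrite /zvec nth_cat sz; case: s => [k||k] /=.
- by rewrite ltn_ord nthc.
- by rewrite ltnn subnn.
have kn := ltn_ord k; rewrite ifF; last by apply/negP; lia.
rewrite (_ : n.*2 - k - n = (n - k.+1).+1)%N; last lia.
rewrite /= nth_rev sz; last lia.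
by rewrite (_ : n - (n - k.+1).+1 = k)%N ?(nthc (fun i => (v i)^-1)) //; lia.
Qed.

Lemma wgt_offdiagE (a : letter n) : wgt_offdiag x y z0 a =
  if odd (rank a) then plain_wt (rank a)./2 else primed_wt (rank a)./2.
Proof.
by rewrite odd_rank half_rank /plain_wt /primed_wt; case: a => [[k||k] []];
   rewrite !nth_zvec.
Qed.

Lemma wgt_diagE (a : letter n) : wgt_diag x y z0 a = diag_wt (symbol_rank a.1).
Proof.
rewrite /diag_wt; case: a => [[k||k] b] /=; first by rewrite valK.
  by rewrite insubN // ltnn.
by rewrite insubN //; have := ltn_ord k; lia.
Qed.

Variable lam : seq nat.
Hypothesis lam_size : size lam = n.
Hypothesis lam_strict : forall i, (i.+1 < n)%N -> (nth 0 lam i.+1 < nth 0 lam i)%N.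
Hypothesis lam_pos : forall i, (i < n)%N -> (0 < nth 0 lam i)%N.

Lemma shifted_diagE :
  shifted_diag lam = cells n id (fun i => i + nth 0 lam i)%N.
Proof.
rewrite /shifted_diag /cells lam_size; congr flatten; apply: eq_map => i.
by rewrite addKn.
Qed.

Lemma mem_shifted i j : ((i, j) \in shifted_diag lam) =
  [&& i < n, i <= j & j < i + nth 0 lam i]%N.
Proof. by rewrite shifted_diagE mem_cells. Qed.

Lemma lam_le i j : (i <= j)%N -> (j < n)%N ->
  (j + nth 0 lam j <= i + nth 0 lam i)%N.
Proof.
elim: j => [|j IH]; first by rewrite leqn0 => /eqP ->.
rewrite leq_eqVlt => /orP[/eqP -> //|ij] jn.
by have := lam_strict jn; have := IH ij (ltnW jn); lia.
Qed.

Lemma mem_diag j : (j < n)%N -> (j, j) \in shifted_diag lam.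
Proof. by move=> jn; rewrite mem_shifted jn leqnn /=; have := lam_pos jn; lia. Qed.

Local Notation fill := {ffun seq_sub (shifted_diag lam) -> letter n}.
Let a0 : letter n := (Zero, true).

(** Through the corner [(i, j')]: if both steps were equalities, one letter would be unprimed by the
    row condition and primed by the column condition. *)
Lemma valid_diag_lt (f : nat * nat -> letter n) i j i' j' :
  validf (@rank n) even_rank (shifted_diag lam) f ->
  (i, j) \in shifted_diag lam -> (i', j') \in shifted_diag lam ->
  (i < i')%N -> (j < j')%N -> (rank (f (i, j)) < rank (f (i', j')))%N.
Proof.
move=> [Hr Hc] c c' ii' jj'.
have c2 : (i, j') \in shifted_diag lam.
  move: c c'; rewrite !mem_shifted => /and3P[h1 h2 h3] /and3P[h4 h5 h6].
  by have := lam_le (ltnW ii') h4; lia.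
have := Hr _ _ _ c c2 jj'; have := Hc _ _ _ c2 c' ii'.
rewrite /row_ok /col_ok; case/orP => [h1|/andP[/eqP e1 p1]].
  by case/orP => [h2|/andP[/eqP -> _]] //; apply: ltn_trans h1.
by rewrite -e1; case/orP => // /andP[/eqP e2]; rewrite e2 p1.
Qed.

(** As [rank] is injective, weak increase with the bans on repetition amounts to [valid]; strict
    increase along diagonals follows by [valid_diag_lt]. *)
Lemma primed_tableauE (P : fill) :
  is_primed_tableau P = [&& valid (@rank n) even_rank P,
    [forall b, on_diag b ==> ~~ primed (P b)] &
    [forall k : 'I_n, #|[set b | on_diag b &
         (P b == (Plain k, false)) || (P b == (Bar k, false))]| == 1%N]].
Proof.
rewrite /is_primed_tableau; apply/idP/idP.
  case/and5P => H1 H2 _ H4 /and3P[H5 -> ->]; rewrite !andbT.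
  apply/forallP => b; apply/forallP => c; apply/andP; split.
    apply/implyP => /andP[e1 lt].
    have := forallP (forallP H1 b) c; rewrite e1 lt /= /row_ok leq_eqVlt orbC.
    case/orP => [-> //|/eqP/rank_inj e]; rewrite e eqxx /= /even_rank negbK odd_rank.
    have := forallP (forallP H4 b) c; rewrite e1 e eqxx /= andbT => /implyP -> //.
      by rewrite orbT.
    by apply/eqP => bc; move: lt; rewrite bc ltnn.
  apply/implyP => /andP[e1 lt].
  have := forallP (forallP H2 b) c; rewrite e1 lt /= /col_ok leq_eqVlt orbC.
  case/orP => [-> //|/eqP/rank_inj e]; rewrite e eqxx /= /even_rank odd_rank negbK.
  have := forallP (forallP H5 b) c; rewrite e1 e eqxx /= andbT => /implyP -> //.
    by rewrite orbT.
  by apply/eqP => bc; move: lt; rewrite bc ltnn.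
case/and3P => vP -> ->; rewrite !andbT; have /(validP _ _ a0) vf := vP.
have vr b c : row_of b = row_of c -> (col_of b < col_of c)%N ->
    row_ok (@rank n) even_rank (P b) (P c).
  move=> e1 lt; have /forallP/(_ b)/forallP/(_ c)/andP[/implyP h _] := vP.
  by apply: h; rewrite e1 eqxx.
have vc b c : col_of b = col_of c -> (row_of b < row_of c)%N ->
    col_ok (@rank n) even_rank (P b) (P c).
  move=> e1 lt; have /forallP/(_ b)/forallP/(_ c)/andP[_ /implyP h] := vP.
  by apply: h; rewrite e1 eqxx.
have bne (b c : seq_sub (shifted_diag lam)) : b != c ->
    ~ (row_of b = row_of c /\ col_of b = col_of c).
  move=> /eqP ne [e1 e2]; apply: ne; apply: val_inj; move: e1 e2.
  by rewrite /row_of /col_of; case: (val b) (val c) => [? ?] [? ?] /= -> ->.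
apply/and5P; split.
- apply/forallP => b; apply/forallP => c; apply/implyP => /andP[/eqP e1 lt].
  exact: row_ok_rk (vr _ _ e1 lt).
- apply/forallP => b; apply/forallP => c; apply/implyP => /andP[/eqP e1 lt].
  exact: col_ok_rk (vc _ _ e1 lt).
- apply/forallP => b; apply/forallP => c; apply/implyP => /andP[/eqP e1 /eqP e2].
  rewrite -!(entry_val a0); move: e1 e2 (valP b) (valP c); rewrite /row_of /col_of.
  case: (val b) (val c) => [i j] [i' j'] /= -> -> hb hc.
  exact: (valid_diag_lt vf hb hc).
- apply/forallP => b; apply/forallP => c; apply/implyP => /and3P[bc /eqP e1 /eqP e2].
  have := bne _ _ bc; case: (ltngtP (col_of b) (col_of c)) => lt ne.
  + by have := vr _ _ e1 lt; rewrite /row_ok e2 ltnn eqxx /= /even_rank negbK odd_rank.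
  + by have := vr _ _ (esym e1) lt; rewrite /row_ok e2 ltnn eqxx /= /even_rank negbK odd_rank.
  + by case: ne.
- apply/forallP => b; apply/forallP => c; apply/implyP => /and3P[bc /eqP e1 /eqP e2].
  have := bne _ _ bc; case: (ltngtP (row_of b) (row_of c)) => lt ne.
  + by have := vc _ _ e1 lt; rewrite /col_ok e2 ltnn eqxx /= /even_rank odd_rank negbK.
  + by have := vc _ _ (esym e1) lt; rewrite /col_ok e2 ltnn eqxx /= /even_rank odd_rank negbK.
  + by case: ne.
Qed.

Definition diag_letter (P : fill) (j : nat) : letter n := entry a0 P (j, j).
Definition diag_ranks (P : fill) : {ffun 'I_n -> 'I_n.*2.+1} :=
  [ffun j : 'I_n => inord (symbol_rank (diag_letter P j).1)].

Lemma diag_ranksE P (j : 'I_n) :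
  diag_ranks P j = symbol_rank (diag_letter P j).1 :> nat.
Proof. by rewrite ffunE inordK // ltnS symbol_rank_le. Qed.

Lemma on_diagP b : reflect (exists2 j, (j < n)%N & val b = (j, j)) (@on_diag (shifted_diag lam) b).
Proof.
rewrite /on_diag /row_of /col_of; move: (valP b); case: (val b) => i j /= h.
apply: (iffP eqP) => [e|[k _ [-> ->]] //].
by subst j; exists i => //; move: h; rewrite mem_shifted => /and3P[].
Qed.

Definition diag_set (P : fill) (k : 'I_n) :=
  [set b | on_diag b & (P b == (Plain k, false)) || (P b == (Bar k, false))].

Lemma diag_setP P (k : 'I_n) (j : nat) (h : (j, j) \in shifted_diag lam) :
  (SeqSub h \in diag_set P k) = (has_label (diag_letter P j) k).
Proof.
rewrite inE /on_diag /row_of /col_of /= eqxx /= /diag_letter.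
by rewrite -[(j, j)]/(val (SeqSub h)) entry_val.
Qed.

Lemma tableau_antipode_free P : is_primed_tableau P ->
  incr (diag_ranks P) /\ antipode_free n (ext (diag_ranks P)).
Proof.
rewrite primed_tableauE => /and3P[/(validP _ _ a0) vf /forallP Hu /forallP Hk].
have unpr j : (j < n)%N -> primed (diag_letter P j) = false.
  move=> jn; have := Hu (SeqSub (mem_diag jn)); rewrite -(entry_val a0).
  by rewrite /on_diag /row_of /col_of /= eqxx => /negbTE.
have rkE j : (j < n)%N -> rank (diag_letter P j) = (symbol_rank (diag_letter P j).1).*2.+1.
  by move=> jn; rewrite /rank unpr //= addn1.
split.
  apply/incrP => i j ij; rewrite !diag_ranksE.
  have := valid_diag_lt vf (mem_diag (ltn_ord i)) (mem_diag (ltn_ord j)) ij ij.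
  by rewrite -!/(diag_letter _ _) !rkE //; lia.
move=> i j im jn.
rewrite -[i]/(val (Ordinal im)) -[j]/(val (Ordinal jn)) !extE !diag_ranksE /= => e.
(* Choosing a diagonal box for each label is injective between sets of size [n], so every diagonal
   box has a label. Antipodal symbols would share a label, hence a box. *)
have hit (k : 'I_n) : {j : 'I_n | has_label (diag_letter P j) k}.
  apply: cid; have /cards1P[b eb] := Hk k.
  have : b \in diag_set P k by rewrite /diag_set eb set11.
  move=> hb; have := hb; rewrite inE => /andP[/on_diagP[l ln vb] _].
  exists (Ordinal ln); rewrite -(diag_setP _ _ (mem_diag ln)).
  by rewrite (_ : SeqSub _ = b) //; apply: val_inj; rewrite vb.
have one (k : 'I_n) l l' : (l < n)%N -> (l' < n)%N ->
   has_label (diag_letter P l) k ->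
   has_label (diag_letter P l') k -> l = l'.
  move=> ln l'n; rewrite -(diag_setP _ _ (mem_diag ln)) -(diag_setP _ _ (mem_diag l'n)).
  have /cards1P[b eb] := Hk k; rewrite /diag_set eb !inE => /eqP <- /eqP e'.
  by have /(congr1 val) /= [] := e'.
have finj : injective (fun k => sval (hit k)).
  move=> k k'; case: (hit k) => /= l hl; case: (hit k') => /= l' hl' el.
  by apply: has_label_inj hl'; rewrite -el.
have getk l (ln : (l < n)%N) : exists k : 'I_n,
    has_label (diag_letter P l) k.
  have /codomP[k ek] := injF_onto finj (Ordinal ln).
  by exists k; move: ek; case: (hit k) => /= l' hl' e'; move: hl'; rewrite -e'.
have [k hk] := getk _ im; have [k' hk'] := getk _ jn.
have kn := ltn_ord k; have kn' := ltn_ord k'.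
have kk' : k = k'.
  apply: val_inj; move: e hk hk'; rewrite /has_label => e.
  by move=> /orP[] /eqP e1 /orP[] /eqP e2; move: e; rewrite e1 e2 /=; lia.
subst k'; have ij := one _ _ _ im jn hk hk'; subst j.
by move: e hk; rewrite /has_label => e /orP[] /eqP e1; move: e; rewrite e1 /=; lia.
Qed.

Definition diag_is (p : nat -> nat) (P : fill) : bool :=
  [forall j : 'I_n, rank (diag_letter P j) == (p j).*2.+1].

(** An increasing antipode-free diagonal carries each label at least once by [antipode_free_hits],
    and at most once because two such boxes would have equal or antipodal symbols. *)
Lemma tableau_with_diag (p : {ffun 'I_n -> 'I_n.*2.+1}) P :
  incr p -> antipode_free n (ext p) ->
  is_primed_tableau P && (diag_ranks P == p) =
  [&& valid (@rank n) even_rank P, below (@rank n) n.*2.+1.*2 P & diag_is (ext p) P].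
Proof.
move=> /incrP pincr pfree.
have -> : below (@rank n) n.*2.+1.*2 P.
  by apply/forallP => b; rewrite /rank; have := symbol_rank_le (P b).1;
     case: (primed _) => /=; lia.
rewrite primed_tableauE -!andbA /=; case vP : (valid _ _ P) => //=.
apply/and3P/forallP => [[/forallP Hu _ /eqP ep] j|H].
  rewrite extE -ep diag_ranksE /rank.
  have := Hu (SeqSub (mem_diag (ltn_ord j))); rewrite -(entry_val a0).
  rewrite /on_diag /row_of /col_of /= eqxx /diag_letter /= => ->.
  by rewrite addn1.
have unpr (j : 'I_n) : primed (diag_letter P j) = false.
  by have := H j; rewrite -[primed _]negbK -odd_rank => /eqP ->; rewrite /= odd_double.
have dE (j : 'I_n) : symbol_rank (diag_letter P j).1 = p j.
  by rewrite -half_rank (eqP (H j)) extE /= uphalf_double.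
have lE (j : 'I_n) (k : 'I_n) : (has_label (diag_letter P j) k)
   = (p j == k :> nat) || (p j == (n.*2 - k)%N :> nat).
  rewrite -dE; have := unpr j; case: (diag_letter P j) => s b; rewrite /primed /= => ->.
  rewrite /has_label !xpair_eqE !andbT -!(inj_eq (@symbol_rank_inj n)) //.
split.
- apply/forallP => b; apply/implyP => /on_diagP[j jn vb].
  by rewrite -(entry_val a0) vb; have := unpr (Ordinal jn) => ->.
- apply/forallP => k.
  have [||j jn hj] := @antipode_free_hits n (ext p) k _ _ pfree (ltn_ord k).
  + move=> i j ij jn; have im := ltn_trans ij jn.
    by rewrite -[i]/(val (Ordinal im)) -[j]/(val (Ordinal jn)) !extE; apply: pincr.
  + by move=> j jn; rewrite -[j]/(val (Ordinal jn)) extE -ltnS ltn_ord.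
  apply/cards1P; exists (SeqSub (mem_diag jn)); apply/setP => b; rewrite -/(diag_set P k).
  rewrite finset.in_set1; apply/idP/eqP => [hb|->]; last first.
    rewrite diag_setP (lE (Ordinal jn)); move: hj.
    by rewrite -{1 2}[j]/(val (Ordinal jn)) extE => -[] ->; rewrite eqxx ?orbT.
  have := hb; rewrite inE => /andP[/on_diagP[l ln vb] _].
  have eb : b = SeqSub (mem_diag ln) by apply: val_inj; rewrite vb.
  move: hb; rewrite eb diag_setP (lE (Ordinal ln)) => hl.
  suff e : l = j by apply: val_inj; rewrite /= e.
  have := pfree l j ln jn; move: hj hl.
  have -> : ext p l = p (Ordinal ln) by exact: (extE p (Ordinal ln)).
  have -> : ext p j = p (Ordinal jn) by exact: (extE p (Ordinal jn)).
  have kn := ltn_ord k.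
  have [lt|lt|//] := ltngtP l j.
    have := pincr (Ordinal ln) (Ordinal jn) lt.
    by move=> h [] h1 /orP[] /eqP h2; lia.
  have := pincr (Ordinal jn) (Ordinal ln) lt.
  by move=> h [] h1 /orP[] /eqP h2; lia.
by apply/eqP/ffunP => j; apply: val_inj; rewrite /= diag_ranksE dE.
Qed.

Lemma tableau_weight (p : {ffun 'I_n -> 'I_n.*2.+1}) (P : fill) :
  \prod_c fixed_diag_wt plain_wt primed_wt diag_wt (ext p) (val c) (rank (P c)) =
  (diag_is (ext p) P)%:R * wgt x y z0 P.
Proof.
case: (boolP (diag_is (ext p) P)) => [/forallP H|/forallPn[j /negPf nj]].
  rewrite mul1r /wgt; apply: eq_bigr => b _.
  case: (boolP (on_diag b)) => [/on_diagP[j jn vb]|nb]; last first.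
    by rewrite /fixed_diag_wt ifF ?wgt_offdiagE //; apply/negbTE.
  rewrite -(entry_val a0) vb /fixed_diag_wt /= eqxx.
  have := H (Ordinal jn); rewrite /diag_letter /= => /eqP e.
  by rewrite e eqxx mul1r wgt_diagE -half_rank e /= uphalf_double.
rewrite mul0r (bigD1 (SeqSub (mem_diag (ltn_ord j)))) //=.
rewrite -(entry_val a0) /fixed_diag_wt /= eqxx.
by rewrite [rank _ == _]nj !mul0r.
Qed.

Lemma tableau_sumE :
  tableau_sum x y z0 lam =
  \sum_(p : {ffun 'I_n -> 'I_n.*2.+1} | incr p && `[< antipode_free n (ext p) >])
    fsum (@rank n) even_rank (fixed_diag_wt plain_wt primed_wt diag_wt (ext p))
      n.*2.+1.*2 (cells n id (fun i => i + nth 0 lam i)%N).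
Proof.
rewrite /tableau_sum (partition_big diag_ranks
  (fun p => incr p && `[< antipode_free n (ext p) >])); last first.
  by move=> P /tableau_antipode_free[-> ?]; apply/asboolP.
apply: eq_bigr => p /andP[pi /asboolP pf]; rewrite -shifted_diagE /fsum.
rewrite (eq_bigl _ _ (fun P => tableau_with_diag P pi pf)).
under [RHS]eq_bigr => P _ do rewrite tableau_weight.
rewrite big_mkcond [RHS]big_mkcond; apply: eq_bigr => P _.
by case: (valid _ _ P); case: (below _ _ P); case: (diag_is _ P);
   rewrite /= ?mul1r ?mul0r.
Qed.

End Weights.

(** * Self-dual polynomials *)

Section SelfDual.
Variable F : fieldType.
Implicit Types p q g : {poly F}.

(* t^m p(-1/t). *)
Definition dual (m : nat) (p : {poly F}) : {poly F} :=
  \poly_(j < m.+1) ((-1) ^+ (m - j) * p`_(m - j)).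

Lemma coef_dual m p j : (dual m p)`_j =
  if (j <= m)%N then (-1) ^+ (m - j) * p`_(m - j) else 0.
Proof. by rewrite coef_poly ltnS. Qed.

Lemma dualD m p q : dual m (p + q) = dual m p + dual m q.
Proof.
by apply/polyP => j; rewrite coefD !coef_dual coefD; case: ifP;
   rewrite ?addr0 // mulrDr.
Qed.

Lemma dualZ m c p : dual m (c *: p) = c *: dual m p.
Proof.
by apply/polyP => j; rewrite coefZ !coef_dual coefZ; case: ifP;
   rewrite ?mulr0 // mulrCA.
Qed.

Lemma dualB m p q : dual m (p - q) = dual m p - dual m q.
Proof. by rewrite -scaleN1r dualD dualZ scaleN1r. Qed.

Lemma dual_sum m k (f : 'I_k -> {poly F}) :
  dual m (\sum_i f i) = \sum_i dual m (f i).
Proof.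
apply: (big_morph (dual m)) => [p q|]; first exact: dualD.
by apply/polyP => j; rewrite coef_dual !coef0 mulr0 if_same.
Qed.

Lemma dualXn m i : (i <= m)%N -> dual m 'X^i = (-1) ^+ i *: 'X^(m - i).
Proof.
move=> im; apply/polyP => j; rewrite coef_dual coefZ !coefXn.
case: leqP => jm; last by rewrite (_ : (j == m - i)%N = false) ?mulr0 //; apply/eqP; lia.
case: (eqVneq j (m - i)%N) => [->|ne]; first by rewrite subKn // eqxx.
by rewrite (_ : (m - j == i)%N = false) ?mulr0 //; apply/eqP; move/eqP: ne; lia.
Qed.

Lemma poly_small m p : (size p <= m.+1)%N -> p = \sum_(i < m.+1) p`_i *: 'X^i.
Proof.
move=> sp; apply/polyP => j; rewrite coef_sum.
under eq_bigr => i _ do rewrite coefZ coefXn.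
case: (ltnP j m.+1) => jm.
  rewrite (bigD1 (Ordinal jm)) //= eqxx mulr1 big1 ?addr0 // => i.
  by rewrite -val_eqE /= eq_sym => /negPf ->; rewrite mulr0.
rewrite nth_default ?(leq_trans sp) // big1 // => i _.
by rewrite (_ : (j == i) = false) ?mulr0 //; apply/eqP; have := ltn_ord i; lia.
Qed.

(** Bilinearity reduces this to monomials; the size bounds are needed because [dual m] drops what
    lies above degree [m]. *)
Lemma dualM m m' p q : (size p <= m.+1)%N -> (size q <= m'.+1)%N ->
  dual (m + m') (p * q) = dual m p * dual m' q.
Proof.
move=> /poly_small -> /poly_small ->.
rewrite (dual_sum m) (dual_sum m') !big_distrl /= dual_sum; apply: eq_bigr => i _.
rewrite !big_distrr /= dual_sum; apply: eq_bigr => j _.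
have im := ltn_ord i; have jm := ltn_ord j.
rewrite !dualZ !dualXn // -scalerAl -scalerAr scalerA dualZ -exprD dualXn; last lia.
rewrite !scalerA -[RHS]scalerAl -scalerAr scalerA -exprD.
by congr (_ *: 'X^_); [rewrite exprD; ring | lia].
Qed.

Lemma size_mul_bound a b p q : (size p <= a.+1)%N -> (size q <= b.+1)%N ->
  (size (p * q)%R <= (a + b).+1)%N.
Proof.
move=> sp sq; apply: leq_trans (size_polyMleq _ _) _.
rewrite -subn1 leq_subLR; apply: leq_trans (leq_add sp sq) _.
by rewrite addSn addnS.
Qed.

Lemma size_prod_le m (f : 'I_m -> {poly F}) :
  (forall i, (size (f i) <= 2)%N) -> (size (\prod_i f i)%R <= m.+1)%N.
Proof.
elim: m f => [|m IH] f sf; first by rewrite big_ord0 size_poly1.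
rewrite big_ord_recr /= -[in X in (_ <= X)%N](addn1 m).
by apply: size_mul_bound => //; apply: IH.
Qed.

Lemma dual_prod m (f : 'I_m -> {poly F}) :
  (forall i, (size (f i) <= 2)%N) -> dual m (\prod_i f i) = \prod_i dual 1 (f i).
Proof.
elim: m f => [|m IH] f sf.
  by rewrite !big_ord0 -[1](expr0 'X) dualXn // scale1r.
rewrite !big_ord_recr /= -[X in dual X _](addn1 m) dualM ?IH // ?size_prod_le //.
Qed.

Definition lin_up (a : F) : {poly F} := a%:P + 'X.
Definition lin_down (a : F) : {poly F} := 1 - a *: 'X.

Lemma size_lin_up a : (size (lin_up a) <= 2)%N.
Proof. by rewrite /lin_up addrC size_XaddC. Qed.

Lemma size_lin_down a : (size (lin_down a) <= 2)%N.
Proof.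
apply: leq_trans (size_polyD _ _) _; rewrite size_poly1 size_polyN geq_max /=.
by apply: leq_trans (size_scale_leq _ _) _; rewrite size_polyX.
Qed.

Lemma dual_lin_up a : dual 1 (lin_up a) = - lin_down a.
Proof.
rewrite /lin_up -alg_polyC -[in a%:A](expr0 'X) -['X in X in dual _ X]expr1 dualD dualZ !dualXn //.
by rewrite /lin_down scale1r subnn !subn0 expr0 expr1 scaleN1r opprB addrC.
Qed.

Lemma dual_lin_down a : dual 1 (lin_down a) = lin_up a.
Proof.
rewrite /lin_down dualB dualZ -(expr0 'X) -{2}(expr1 'X) !dualXn //.
rewrite /lin_up scale1r subnn subn0 expr1 scalerA mulrN1 scaleNr opprK addrC.
by rewrite expr0 alg_polyC.
Qed.

(** The sign makes ['X^d] self-dual and lets the indices [d] add under products. *)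
Definition self_dual (d : nat) (g : {poly F}) : Prop :=
  (size g <= d.*2.+1)%N /\ dual d.*2 g = (-1) ^+ d *: g.

Lemma self_dualM d d' g g' : self_dual d g -> self_dual d' g' ->
  self_dual (d + d') (g * g').
Proof.
move=> [s1 e1] [s2 e2]; split.
  apply: leq_trans (size_polyMleq _ _) _; lia.
by rewrite doubleD dualM // e1 e2 -scalerAl -scalerAr scalerA exprD.
Qed.

Lemma self_dualXn d : self_dual d 'X^d.
Proof.
split; first by rewrite size_polyXn; lia.
by rewrite dualXn; [congr (_ *: 'X^_); lia | lia].
Qed.

Lemma self_dual_prod k (f : 'I_k -> {poly F}) :
  (forall i, self_dual 1 (f i)) -> self_dual k (\prod_i f i).
Proof.
elim: k f => [|k IH] f sf.
  by rewrite big_ord0 -(expr0 'X); apply: self_dualXn.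
rewrite big_ord_recr /= -[X in self_dual X _](addn1 k).
by apply: self_dualM => //; apply: IH.
Qed.

Lemma self_dualB d g g' : self_dual d g -> self_dual d g' -> self_dual d (g - g').
Proof.
move=> [s1 e1] [s2 e2]; split; last by rewrite dualB e1 e2 scalerBr.
by apply: leq_trans (size_polyD _ _) _; rewrite size_polyN geq_max s1.
Qed.

Lemma self_dualZ d c g : self_dual d g -> self_dual d (c *: g).
Proof.
move=> [s1 e1]; split; first exact: leq_trans (size_scale_leq _ _) s1.
by rewrite dualZ e1 !scalerA mulrC.
Qed.

Lemma coef_self_dual d g i : self_dual d g -> (i <= d.*2)%N ->
  g`_(d.*2 - i) = (-1) ^+ (d + i) * g`_i.
Proof.
move=> [_ /(congr1 (fun p : {poly F} => p`_i))]; rewrite coef_dual coefZ => e id.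
move: e; rewrite id => /(congr1 (fun t => (-1) ^+ i * t)).
rewrite mulrA -exprD subnKC // -signr_odd odd_double mul1r => ->.
by rewrite mulrA -exprD addnC.
Qed.

(* Subtracting a multiple of the full product of the kap_j kills the constant
   coefficient, hence by duality the top one; the rest is divisible by X. *)
Lemma self_dual_newton (kap : nat -> {poly F}) d g :
  (forall i, self_dual 1 (kap i)) -> (forall i, (kap i)`_0 = 1) -> self_dual d g ->
  exists c : nat -> F,
    g = \sum_(i < d.+1) c i *: ('X^(d - i) * \prod_(j < i) kap j).
Proof.
move=> ks k1; elim: d g => [|d IH] g gs.
  exists (fun _ => g`_0); rewrite big_ord1 big_ord0 mulr1 expr0.
  by rewrite alg_polyC -size1_polyC //; case: gs.
have pk1 m : (\prod_(j < m) kap j)`_0 = 1.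
  elim: m => [|m IHm]; first by rewrite big_ord0 coef1.
  by rewrite big_ord_recr /= coef0M IHm k1 mulr1.
pose g1 := g - g`_0 *: \prod_(j < d.+1) kap j.
have g1s : self_dual d.+1 g1.
  by apply: self_dualB => //; apply/self_dualZ/self_dual_prod.
have g10 : g1`_0 = 0 by rewrite coefB coefZ pk1 mulr1 subrr.
have [g2 eg] : exists g2, g1 = 'X * g2.
  have : root g1 0 by rewrite rootE horner_coef0 g10.
  by move=> /factor_theorem[g2 ->]; exists g2; rewrite subr0 mulrC.
have g2s : self_dual d g2.
  have [s1 e1] := g1s.
  have sg2 : (size g2 <= d.*2.+1)%N.
    have [->|nz] := eqVneq g2 0; first by rewrite size_poly0.
    have s2 : size g1 = (size g2).+1 by rewrite eg mulrC size_mulX.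
    have top : g1`_(d.+1.*2) = 0.
      by rewrite -[d.+1.*2]subn0 (coef_self_dual g1s) // g10 mulr0.
    rewrite leqNgt; apply/negP => lt.
    have s3 : size g2 = d.*2.+2 by move: s1; rewrite s2 doubleS; lia.
    case/eqP: nz; apply/eqP; rewrite -lead_coef_eq0 lead_coefE s3 /=.
    by have := top; rewrite eg coefXM doubleS /= => ->.
  split=> //; move: e1; rewrite eg doubleS -addn2 addnC dualM //; last first.
    by rewrite size_polyX.
  have -> : dual 2 'X = - 'X.
    by rewrite -(expr1 'X) dualXn // expr1 scaleN1r.
  rewrite mulNr exprS mulN1r scaleNr => /oppr_inj; rewrite scalerAr.
  by apply: mulfI; rewrite polyX_eq0.
have [c ec] := IH g2 g2s.
exists (fun i => if (i < d.+1)%N then c i else g`_0).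
rewrite big_ord_recr /= ltnn subnn expr0 mul1r.
rewrite -[LHS](subrK (g`_0 *: \prod_(j < d.+1) kap j)) -/g1; congr (_ + _).
rewrite eg ec big_distrr /=; apply: eq_bigr => i _.
by rewrite ltn_ord -scalerAr mulrA -exprS subSn // -ltnS.
Qed.

(** At a square root [i] of -1, [lin_up a] is [i] times [lin_down a], which suggests the
    divisibility. The induction builds the quotient instead, over any field. *)
Lemma antipode_quotient (a : nat -> F) d : exists Q,
  \prod_(b < d.*2.+1) lin_up (a b) - (-1) ^+ d *: ('X * \prod_(b < d.*2.+1) lin_down (a b))
  = (1 + 'X^2) * Q.
Proof.
elim: d => [|d [Q eQ]].
  exists (a 0%N)%:P; rewrite !big_ord1 scale1r /lin_up /lin_down -mul_polyC.
  ring.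
set U := \prod_(b < d.*2.+1) lin_up (a b) in eQ *.
set V := \prod_(b < d.*2.+1) lin_down (a b) in eQ *.
rewrite doubleS !(big_ord_recr d.*2.+2) !(big_ord_recr d.*2.+1) /= -/U -/V.
set s := a d.*2.+1; set t := a d.*2.+2.
(* The second summand comes from [lin_up s * lin_up t + lin_down s * lin_down t = (1 + s * t) (1 +
   'X^2)]. *)
exists (lin_up s * lin_up t * Q + (-1) ^+ d *: ('X * V) * (1 + s * t)%:P).
have eU : U = (1 + 'X^2) * Q + (-1) ^+ d *: ('X * V) by rewrite -eQ subrK.
have -> : (-1) ^+ d.+1 = - (-1) ^+ d :> F by rewrite exprS mulN1r.
rewrite eU; move: ((-1) ^+ d) => e; rewrite /lin_up /lin_down -!mul_polyC.
rewrite polyCN polyCD polyCM polyC1; ring.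
Qed.

(* The value of g at 1/a_0 is read off without dividing by 1 + 1/a_0^2, which may
   vanish, because the quotient Q of [antipode_quotient] does not involve a_0. *)
Lemma self_dual_quotient (a : nat -> F) d : a 0%N != 0 ->
  exists g, [/\ self_dual d g,
    \prod_(b < d.*2.+2) lin_up (a b) + (-1) ^+ d *: \prod_(b < d.*2.+2) lin_down (a b)
      = (1 + 'X^2) * g &
    g.[(a 0%N)^-1] * a 0%N ^+ d =
      a 0%N ^- d * \prod_(b < d.*2.+1) (1 + a 0%N * a b.+1)].
Proof.
move=> a0; have [Q eQ] := antipode_quotient (fun b => a b.+1) d.
rewrite !(big_ord_recl d.*2.+1) /= /bump /=.
under [X in _ * X + _]eq_bigr => b _ do rewrite add1n.
under [X in _ + _ *: (_ * X)]eq_bigr => b _ do rewrite add1n.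
set U := \prod_(b < _) _ in eQ *; set V := \prod_(b < _) lin_down _ in eQ *.
(* Substitute the expression of [U] by [Q] and [V]; the factor of [V] is then
   [(a_0 + X) X + 1 - a_0 X = 1 + X^2]. *)
pose g := lin_up (a 0%N) * Q + (-1) ^+ d *: V.
have eB : lin_up (a 0%N) * U + (-1) ^+ d *: (lin_down (a 0%N) * V) = (1 + 'X^2) * g.
  have eU : U = (1 + 'X^2) * Q + (-1) ^+ d *: ('X * V) by rewrite -eQ subrK.
  rewrite /g eU /lin_up /lin_down -!mul_polyC; ring.
have sU : (size U <= d.*2.+2)%N by apply: size_prod_le => b; apply: size_lin_up.
have sV : (size V <= d.*2.+2)%N by apply: size_prod_le => b; apply: size_lin_down.
have nz : 1 + 'X^2 != 0 :> {poly F}.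
  by apply/eqP => /(congr1 (fun p : {poly F} => p`_2)) /eqP;
     rewrite coefD coef1 coefXn coef0 add0r oner_eq0.
have s1X : size (1 + 'X^2 : {poly F}) = 3.
  by rewrite addrC size_polyDl size_polyXn // size_poly1.
exists g; split.
- have dU : dual d.*2.+1 U = - V.
    rewrite dual_prod; last by move=> b; apply: size_lin_up.
    under eq_bigr => b _ do rewrite dual_lin_up.
    by rewrite prodrN card_ord -signr_odd /= odd_double expr1 mulN1r.
  have dV : dual d.*2.+1 V = U.
    rewrite dual_prod; last by move=> b; apply: size_lin_down.
    by under eq_bigr => b _ do rewrite dual_lin_down.
  have sB : (size ((1 + 'X^2) * g)%R <= d.*2.+3)%N.
    rewrite -eB; apply: leq_trans (size_polyD _ _) _; rewrite geq_max.
    rewrite (size_mul_bound (size_lin_up _) sU) /=.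
    apply: leq_trans (size_scale_leq _ _) _.
    exact: (size_mul_bound (size_lin_down _) sV).
  have sg : (size g <= d.*2.+1)%N.
    have [->|gnz] := eqVneq g 0; first by rewrite size_poly0.
    by move: sB; rewrite size_mul // s1X; exact: id.
  (* Duality is multiplicative and fixes [1 + 'X^2], so the sign found for the product passes to [g]
     by cancellation. *)
  split=> //; apply: (mulfI nz).
  have d1X : dual 2 (1 + 'X^2) = 1 + 'X^2.
    by rewrite dualD -(expr0 'X) !dualXn // subnn subn0 expr0 sqrrN expr1n !scale1r addrC.
  rewrite -{1}d1X -dualM ?s1X // -eB dualD dualZ -scalerAr -eB -[(2 + _)%N]/(1 + d.*2.+1)%N.
  rewrite !dualM // ?size_lin_up ?size_lin_down // dual_lin_up dual_lin_down dU dV.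
  by rewrite mulrNN scalerDr scalerA -expr2 sqrr_sign scale1r addrC.
- exact: eB.
have eQx : (1 + (a 0%N)^-1 ^+ 2) * Q.[(a 0%N)^-1] =
  U.[(a 0%N)^-1] - (-1) ^+ d * ((a 0%N)^-1 * V.[(a 0%N)^-1]).
  by have := congr1 (fun p => p.[(a 0%N)^-1]) eQ; rewrite !hornerE => <-.
have -> : g.[(a 0%N)^-1] = a 0%N * U.[(a 0%N)^-1].
  rewrite /g /lin_up !hornerE.
  have -> : U.[(a 0%N)^-1] = (1 + (a 0%N)^-1 ^+ 2) * Q.[(a 0%N)^-1] +
       (-1) ^+ d * ((a 0%N)^-1 * V.[(a 0%N)^-1]) by rewrite eQx subrK.
  rewrite mulrDr mulrA; congr (_ + _); first by congr (_ * _); field.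
  by field.
have -> : U.[(a 0%N)^-1] =
   a 0%N ^- d.*2.+1 * \prod_(b < d.*2.+1) (1 + a 0%N * a b.+1).
  rewrite horner_prod -exprVn -[in X in _ ^+ X](card_ord d.*2.+1) -prodr_const -big_split.
  by apply: eq_bigr => b _ /=; rewrite /lin_up !hornerE; field.
rewrite (_ : d.*2.+1 = d + d.+1)%N; last lia.
rewrite exprD exprS; have := expf_neq0 d a0; move: (a 0%N ^+ d) => c c0.
by field; rewrite c0 a0.
Qed.

End SelfDual.

(** * The change of basis *)

Section Denominator.
Variables (F : fieldType) (n : nat) (zz : nat -> F).
Hypothesis zz_neq0 : forall a, (a <= n.*2)%N -> zz a != 0.

(** Newton factor for the node [(zz b)^-1]: self-dual, with constant coefficient 1 and a root at the
    node. *)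
Definition kap (b : nat) : {poly F} := lin_down (zz b) * (1 + (zz b)^-1 *: 'X).

(** The two summands come from the diagonal symbols [k] and [2n - k], whose contributions share the
    factors [kap b] with [b < k]. *)
Definition rest_poly (k : nat) : {poly F} :=
  \prod_(k <= b < n.*2 - k) lin_up (zz b) +
  (-1) ^+ (n - k.+1) *: \prod_(k <= b < n.*2 - k) lin_down (zz b).

Definition num_poly (k : nat) : {poly F} := (\prod_(0 <= b < k) kap b) * rest_poly k.

Definition newton_poly (i : nat) : {poly F} :=
  (1 + 'X^2) * ('X^(n - i.+1) * \prod_(0 <= b < i) kap b).

Definition antipode_poly (m : nat) : {poly F} :=
  'X^m + (-1) ^+ (n - m.+1) *: 'X^(n.*2 - m).

Definition diag_factor (k : nat) : F :=
  zz k ^- (n - k.+1) * \prod_(k.+1 <= b < n.*2 - k) (1 + zz k * zz b).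

Lemma kapE b : zz b != 0 -> kap b = (zz b)^-1 *: (lin_down (zz b) * lin_up (zz b)).
Proof.
move=> z0; rewrite /kap /lin_up scalerAr; congr (_ * _).
by rewrite scalerDr -(alg_polyC (zz b)) scalerA mulVf // scale1r.
Qed.

Lemma self_dual_kap b : zz b != 0 -> self_dual 1 (kap b).
Proof.
move=> z0; rewrite kapE //; apply: self_dualZ; split.
  exact: (size_mul_bound (size_lin_down _) (size_lin_up _)).
rewrite -[1.*2]/(1 + 1)%N dualM ?size_lin_up ?size_lin_down //.
by rewrite dual_lin_up dual_lin_down expr1 scaleN1r mulrN mulrC.
Qed.

Lemma kap_coef0 b : (kap b)`_0 = 1.
Proof.
by rewrite /kap /lin_down coef0M coefB coefD !coefZ coefX coef1 /= !mulr0 subr0 addr0 mulr1.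
Qed.

Lemma kap_root b : zz b != 0 -> (kap b).[(zz b)^-1] = 0.
Proof. by move=> z0; rewrite /kap /lin_down !hornerE divff // subrr mul0r. Qed.

Lemma prod_nat_shift (S : comNzRingType) (f : nat -> S) k m :
  \prod_(k <= b < k + m) f b = \prod_(b < m) f (k + b)%N.
Proof.
rewrite -[X in \prod_(X <= _ < _) _]add0n big_addn addKn big_mkord.
by apply: eq_bigr => b _; rewrite addnC.
Qed.

(** After division by [1 + 'X^2] the self-dual quotient is expanded along [kap k], [kap k.+1], and
    so on. Its first coefficient is read off at [(zz k)^-1], where all later terms vanish. *)
Lemma num_poly_newton k : (k < n)%N -> exists C : nat -> F,
  [/\ forall i, (i < k)%N -> C i = 0, C k = diag_factor k &
      num_poly k = \sum_(i < n) C i *: newton_poly i].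
Proof.
move=> kn; pose d := (n - k.+1)%N.
have zk b : (b < n)%N -> zz b != 0 by move=> bn; apply: zz_neq0; lia.
have zk0 : zz (k + 0)%N != 0 by rewrite addn0 zk.
have [g [gs eB gv]] := @self_dual_quotient _ (fun b => zz (k + b)%N) d zk0.
have rngE (f : nat -> {poly F}) :
    \prod_(k <= b < n.*2 - k) f b = \prod_(b < d.*2.+2) f (k + b)%N.
  by rewrite -prod_nat_shift; congr bigop; congr index_iota; rewrite /d; lia.
(* [self_dual_newton] asks for a factor at every index, while [zz] is known to be nonzero only up to
   [2n]; past the range [kap k] is repeated. *)
pose kp j := if (k + j < n)%N then kap (k + j) else kap k.
have kpE j : (k + j < n)%N -> kp j = kap (k + j) by rewrite /kp => ->.
have [||c ec] := @self_dual_newton _ kp d g _ _ gs.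
- by move=> j; rewrite /kp; case: ifP => h; apply/self_dual_kap/zk.
- by move=> j; rewrite /kp; case: ifP => _; rewrite kap_coef0.
have c0 : c 0%N = diag_factor k.
  rewrite /= addn0 in gv; have := gv; rewrite {1}ec horner_sum (bigD1 ord0) //= [X in _ + X]big1 ?addr0; last first.
    move=> [[|i] hi] //= _; rewrite hornerZ hornerM big_ord_recl hornerM kpE ?addn0 //.
    by rewrite kap_root ?zk // mul0r !mulr0.
  rewrite hornerZ hornerM big_ord0 hornerC mulr1 subn0 hornerXn.
  rewrite -mulrA exprVn mulVf ?expf_neq0 ?zk // mulr1 => ->.
  rewrite /diag_factor -/d; congr (_ * _).
  rewrite (_ : n.*2 - k = k.+1 + d.*2.+1)%N; last by rewrite /d; lia.
  by rewrite prod_nat_shift; apply: eq_bigr => b _; rewrite addSnnS.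
exists (fun i => if (i < k)%N then 0 else c (i - k)%N); split.
- by move=> i ->.
- by rewrite ltnn subnn.
rewrite /num_poly /rest_poly !rngE eB ec.
rewrite -(big_mkord xpredT (fun i => (if (i < k)%N then 0 else c (i - k)%N) *: newton_poly i)).
rewrite [RHS](@big_cat_nat _ _ _ k) ?(ltnW kn) //=.
rewrite [X in _ = X + _](_ : _ = 0) ?add0r; last first.
  by rewrite big_nat big1 // => i /andP[_ ->]; rewrite scale0r.
rewrite -[X in \sum_(X <= _ < _) _]add0n big_addn (_ : n - k = d.+1)%N; last by rewrite /d; lia.
rewrite [RHS]big_mkord mulrCA mulrA big_distrr /=; apply: eq_bigr => i _ /=.
rewrite ltnNge leq_addl /= addnK -scalerAr; congr (_ *: _).
rewrite /newton_poly -mulrA; congr (_ * _); rewrite mulrCA; congr ('X^_ * _).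
  by rewrite /d; lia.
rewrite (@big_cat_nat _ _ _ k _ (i + k)) ?leq_addl //=; congr (_ * _).
rewrite addnC prod_nat_shift; apply: eq_bigr => j _; apply: kpE.
by have := ltn_ord i; have := ltn_ord j; rewrite /d; lia.
Qed.

(** Duality pairs the coefficients of [X^m] and [X^(2n - m)] with the sign of [antipode_poly]. In
    the middle it only says [c = -c], which is empty in characteristic 2; there the factor
    [1 + 'X^2] helps, since the coefficients of [M] at [n] and [n - 2] are opposite. *)
Lemma self_dual_span M : (0 < n)%N -> self_dual n.-1 M ->
  (1 + 'X^2) * M = \sum_(m < n) ((1 + 'X^2) * M)`_m *: antipode_poly m.
Proof.
move=> n0 Ms; set N := (1 + 'X^2) * M.
have sN : (size N <= n.*2.+1)%N.
  rewrite (_ : n.*2 = 2 + n.-1.*2)%N; last lia.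
  apply: size_mul_bound; last by case: Ms.
  by rewrite addrC size_polyDl size_polyXn // size_poly1.
have NE i : N`_i = M`_i + (if (i < 2)%N then 0 else M`_(i - 2)).
  by rewrite /N mulrDl mul1r coefD coefXnM.
have dN i : (i <= n.*2)%N -> N`_(n.*2 - i) = (-1) ^+ (n.-1 + i) * N`_i.
  move=> id; have : dual n.*2 N = (-1) ^+ n.-1 *: N.
    rewrite (_ : n.*2 = 2 + n.-1.*2)%N; last lia.
    have [sM eM] := Ms; rewrite dualM //; last first.
      by rewrite addrC size_polyDl size_polyXn // size_poly1.
    rewrite eM dualD -(expr0 'X) !dualXn // subnn subn0 expr0 sqrrN expr1n !scale1r.
    by rewrite -scalerAr addrC.
  move/(congr1 (fun p : {poly F} => p`_i)); rewrite coef_dual coefZ id.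
  move=> /(congr1 (fun t => (-1) ^+ i * t)).
  rewrite mulrA -exprD subnKC // -signr_odd odd_double mul1r => ->.
  by rewrite mulrA -exprD addnC.
have Nn : N`_n = 0.
  rewrite NE; case: ltnP => n2.
    have n1 : n = 1%N by lia.
    by rewrite addr0 nth_default //; case: Ms; rewrite n1.
  have -> : M`_n = M`_(n.-1.*2 - (n - 2))%N by congr (_`_ _); lia.
  rewrite (coef_self_dual Ms); last lia.
  rewrite -signr_odd (_ : odd _ = true) ?expr1 ?mulN1r ?addNr //.
  by rewrite (_ : (n.-1 + (n - 2) = (n - 2).*2.+1)%N) /= ?odd_double //; lia.
apply/polyP => i; rewrite coef_sum.
under eq_bigr => m _ do rewrite coefZ /antipode_poly coefD coefZ !coefXn.
case: (ltngtP i n) => [lt|gt|->].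
- rewrite (bigD1 (Ordinal lt)) //= eqxx big1 => [|m mi].
    rewrite (_ : (i == n.*2 - i)%N = false) ?mulr0 ?addr0 ?mulr1 //; apply/eqP; lia.
  have ne : (i == m) = false by rewrite eq_sym; apply: negbTE mi.
  have -> : (i == n.*2 - m)%N = false by apply/eqP; have := ltn_ord m; lia.
  by rewrite ne mulr0 addr0 mulr0.
- case: (leqP i n.*2) => i2; last first.
    rewrite nth_default ?(leq_trans sN) // big1 // => m _; have mn := ltn_ord m.
    have -> : (i == m) = false by apply/eqP; lia.
    have -> : (i == n.*2 - m)%N = false by apply/eqP; lia.
    by rewrite mulr0 addr0 mulr0.
  have lt : (n.*2 - i < n)%N by lia.
  rewrite (bigD1 (Ordinal lt)) //= big1 => [|m mi].
    have -> : (i == n.*2 - i)%N = false by apply/eqP; lia.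
    rewrite subKn // eqxx add0r mulr1 addr0 -[in LHS](subKn i2) dN ?leq_subr // mulrC.
    congr (_ * _); rewrite -signr_odd -[RHS]signr_odd; congr (_ ^+ nat_of_bool _).
    by rewrite (_ : n.-1 + (n.*2 - i) = (n - (n.*2 - i).+1) + (n.*2 - i).*2)%N
       ?oddD ?odd_double ?addbF //; lia.
  have -> : (i == m) = false by apply/eqP; have := ltn_ord m; lia.
  have -> : (i == n.*2 - m)%N = false.
    apply/eqP => e; move/eqP: mi; apply; apply: val_inj => /=; have := ltn_ord m; lia.
  by rewrite mulr0 addr0 mulr0.
rewrite Nn big1 // => m _; have mn := ltn_ord m.
have -> : (n == m) = false by apply/eqP; lia.
have -> : (n == n.*2 - m)%N = false by apply/eqP; lia.
by rewrite mulr0 addr0 mulr0.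
Qed.

(** The matrix factors as [U E S]. [U] expands [num_poly] in the Newton basis and is triangular with
    diagonal [diag_factor]; [E] passes to the polynomials [antipode_poly], listed by decreasing
    lowest exponent to make it unitriangular. *)
Lemma det_num_poly (H : {poly F}) (pos : nat -> nat) :
  \det (\matrix_(k < n, j < n) (num_poly k * H)`_(pos j)) =
  (\prod_(k < n) diag_factor k) *
  \det (\matrix_(m < n, j < n) (antipode_poly (n - m.+1) * H)`_(pos j)).
Proof.
have [C HC] : exists C : 'I_n -> nat -> F, forall k : 'I_n,
    [/\ forall i, (i < k)%N -> C k i = 0, C k k = diag_factor k &
      num_poly k = \sum_(i < n) C k i *: newton_poly i].
  have /fin_all_exists[C HC] : forall k : 'I_n, exists C : nat -> F,
     [/\ forall i, (i < k)%N -> C i = 0, C k = diag_factor k &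
      num_poly k = \sum_(i < n) C i *: newton_poly i].
    by move=> k; apply: num_poly_newton.
  by exists C.
pose S := \matrix_(m < n, j < n) (antipode_poly (n - m.+1) * H)`_(pos j).
pose E := \matrix_(i < n, m < n) (newton_poly i)`_(n - m.+1).
pose U := \matrix_(k < n, i < n) C k i.
have pk1 m : (\prod_(0 <= j < m) kap j)`_0 = 1.
  elim: m => [|m IHm]; first by rewrite big_geq // coef1.
  by rewrite big_nat_recr //= coef0M IHm kap_coef0 mulr1.
have dU : \det U = \prod_(k < n) diag_factor k.
  rewrite -det_tr det_trig.
    by apply: eq_bigr => k _; rewrite !mxE; case: (HC k).
  by apply/is_trig_mxP => i j ij; rewrite !mxE; case: (HC j) => h _ _; apply: h.
have EE (i m : 'I_n) : (newton_poly i)`_(n - m.+1) =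
   if (i < m)%N then 0 else if i == m then 1 else (newton_poly i)`_(n - m.+1).
  have im := ltn_ord i; have mn := ltn_ord m.
  rewrite /newton_poly mulrCA coefXnM; case: ltnP => h.
    by rewrite (_ : (i < m)%N = true) //; lia.
  rewrite ifF; last lia.
  case: eqP => [->|//]; rewrite subnn coef0M pk1 mulr1 coefD coef1 coefXn addr0 //.
have dE : \det E = 1.
  rewrite det_trig.
    by rewrite big1 // => i _; rewrite mxE EE ltnn eqxx.
  by apply/is_trig_mxP => i j ij; rewrite mxE EE ij.
rewrite -dU -[\det U]mulr1 -dE -!det_mulmx; congr (\det _).
apply/matrixP => k j; rewrite mxE; have [_ _ ->] := HC k.
rewrite -mulmxA mxE big_distrl /= coef_sum; apply: eq_bigr => i _.
rewrite mxE -scalerAl coefZ; congr (_ * _).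
have n0 : (0 < n)%N by apply: leq_ltn_trans (ltn_ord i).
have in_ := ltn_ord i.
have Ms : self_dual n.-1 ('X^(n - i.+1) * \prod_(0 <= b < i) kap b).
  rewrite (_ : n.-1 = (n - i.+1) + i)%N; last lia.
  apply: self_dualM; first exact: self_dualXn.
  rewrite big_mkord; apply: self_dual_prod => b; apply/self_dual_kap/zz_neq0.
  by have := ltn_ord b; lia.
rewrite mxE {1}/newton_poly self_dual_span // -/(newton_poly i) big_distrl coef_sum /=.
rewrite (reindex_inj rev_ord_inj); apply: eq_bigr => m _ /=.
by rewrite !mxE -scalerAl coefZ.
Qed.

Lemma geom_lin_down N (z : F) : geom N z * lin_down z = 1 - z ^+ N *: 'X^N.
Proof.
rewrite /geom /lin_down poly_def; elim: N => [|N IH].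
  by rewrite big_ord0 mul0r expr0 scale1r subrr.
rewrite big_ord_recr /= mulrDl IH mulrBr mulr1 -scalerAl -scalerAr scalerA -exprSr -exprSr.
by rewrite addrA subrK.
Qed.

Lemma coef_mul_trunc N l f (z : nat -> F) q : (l < N)%N ->
  (f * \prod_(0 <= a < q) (geom N (z a) * lin_down (z a)))`_l = f`_l.
Proof.
move=> lN; elim: q => [|q IH]; first by rewrite big_geq // mulr1.
rewrite big_nat_recr //= mulrA [X in _ * X]geom_lin_down mulrBr mulr1 coefB IH.
by rewrite -scalerAr coefZ coefMXn lN mulr0 subr0.
Qed.

Variables (ww cc : nat -> F).
Hypothesis ww_zz : forall a, (a <= n.*2)%N -> ww a = (zz (n.*2 - a))^-1.
Hypothesis cc_low : forall k, (k < n)%N -> cc k = \prod_(k <= b < n.*2 - k) zz b.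
Hypothesis cc_high : forall k, (k < n)%N -> cc (n.*2 - k)%N = 1.

(** The closed form of [row_polyE] for diagonal symbol [q] and all [2n + 1] symbols. *)
Definition path_poly N q : {poly F} := (cc q *: 'X) * geom N (zz q) *
    \prod_(q.+1 <= a < n.*2.+1) ((1 + ww a *: 'X) * geom N (zz a)).

Definition h_poly N : {poly F} := \prod_(0 <= a < n.*2.+1) geom N (zz a).

(** The factors [geom] missing for [a < q], compensated by [lin_down], complete [h_poly], which does
    not depend on [q]. *)
Lemma path_poly_trunc N l q : (l < N)%N -> (q <= n.*2)%N ->
  (path_poly N q)`_l = (cc q *: ('X * \prod_(0 <= a < q) lin_down (zz a) *
     \prod_(q.+1 <= a < n.*2.+1) (1 + ww a *: 'X)) * h_poly N)`_l.
Proof.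
move=> lN qn; rewrite -(coef_mul_trunc (path_poly N q) zz q lN).
apply: (congr1 (fun p : {poly F} => p`_l)).
rewrite /path_poly /h_poly (@big_cat_nat _ _ _ q 0 n.*2.+1) //=; last lia.
rewrite (@big_ltn _ _ _ q n.*2.+1); last lia.
rewrite !big_split /= -!mul_polyC; ring.
Qed.

Lemma num_polyE k : (k < n)%N ->
  cc k *: ('X * \prod_(0 <= a < k) lin_down (zz a) *
     \prod_(k.+1 <= a < n.*2.+1) (1 + ww a *: 'X)) +
  (-1) ^+ (n - k.+1) *: (cc (n.*2 - k)%N *: ('X * \prod_(0 <= a < n.*2 - k) lin_down (zz a) *
     \prod_((n.*2 - k).+1 <= a < n.*2.+1) (1 + ww a *: 'X))) = 'X * num_poly k.
Proof.
move=> kn; rewrite cc_high // scale1r.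
(* Since [ww] inverts [zz] at the antipode, the symbols after [q] become those before [2n - q]. *)
have flip q : (q <= n.*2)%N -> \prod_(q.+1 <= a < n.*2.+1) (1 + ww a *: 'X) =
    \prod_(0 <= b < n.*2 - q) (1 + (zz b)^-1 *: 'X).
  move=> qn; rewrite big_nat_rev /= [RHS]big_nat [in LHS]big_nat.
  rewrite -[X in \prod_(X <= _ < _ | _) _]add0n big_addn subSS.
  rewrite [LHS]big_nat_cond [RHS]big_nat_cond /=.
  apply: eq_big => [b|b hb]; first by case: ltnP => h; lia.
  by rewrite ww_zz; [congr (1 + (zz _)^-1 *: 'X); lia | lia].
rewrite flip; last lia.
rewrite flip; last lia.
rewrite subKn; last lia.
have kn2 : (k <= n.*2 - k)%N by lia.
rewrite !(@big_cat_nat _ _ _ k 0 (n.*2 - k)) //=.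
(* The diagonal weight [cc k] is exactly what clears the denominators here. *)
have -> : \prod_(k <= b < n.*2 - k) (1 + (zz b)^-1 *: 'X) =
  (cc k)^-1 *: \prod_(k <= b < n.*2 - k) lin_up (zz b).
  rewrite cc_low // -prodfV -scaler_prod; apply: eq_big_nat => b hb.
  have z0 : zz b != 0 by apply: zz_neq0; lia.
  by rewrite /lin_up scalerDr -(alg_polyC (zz b)) scalerA mulVf // scale1r.
have cc0 : cc k != 0.
  by rewrite cc_low //; rewrite prodf_seq_neq0; apply/allP => b; rewrite mem_index_iota => hb;
     apply/implyP => _; apply: zz_neq0; lia.
rewrite /num_poly /rest_poly /kap big_split /=.
have -> : forall P Q : {poly F}, cc k *: (P * (Q * ((cc k)^-1 *: \prod_(k <= b < n.*2 - k) lin_up (zz b)))) =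
   P * (Q * \prod_(k <= b < n.*2 - k) lin_up (zz b)).
  by move=> P Q; rewrite -!scalerAr scalerA divff // scale1r.
rewrite -!mul_polyC; ring.
Qed.

End Denominator.

(** * Partitions whose arms exceed their legs by one *)

Lemma count_initial_segment (p : pred nat) m :
  (forall i j, (i <= j)%N -> p j -> p i) -> (forall i, p i -> (i < m)%N) ->
  forall i, (i < count p (iota 0 m))%N = p i.
Proof.
move=> pd pm.
have [|e' /andP[_ em] he] := @find_initial_segment p 0 m (leq0n m).
  by move=> j j' _ jj' _; apply: pd.
have -> : count p (iota 0 m) = e'.
  rewrite -sum1_count big_mkcond /= (_ : iota 0 m = index_iota 0 m);
    last by rewrite /index_iota subn0.
  rewrite big_mkord -[RHS](sum_lt_ord em); apply: eq_bigr => i _.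
  by rewrite he ?ltn_ord //; case: (_ < _)%N.
move=> i; case: (ltnP i m) => im; first by rewrite he.
rewrite ltnNge (leq_trans em im); apply/esym/negbTE/negP => /pm.
by rewrite ltnNge im.
Qed.

Lemma nth_part_le g i j : is_part g -> (i <= j)%N -> (nth 0 g j <= nth 0 g i)%N.
Proof.
move=> /andP[sg _] ij; case: (ltnP j (size g)) => js; last by rewrite nth_default.
have gtr : transitive geq by move=> a b c /= h1 h2; apply: leq_trans h2 h1.
exact: (sorted_leq_nth gtr leqnn 0%N sg i j (leq_ltn_trans ij js) js ij).
Qed.

Lemma nth_part_gt0 g i : is_part g -> (0 < nth 0 g i)%N = (i < size g)%N.
Proof.
move=> /andP[_ g0]; case: (ltnP i (size g)) => h; last by rewrite nth_default.
by rewrite lt0n; apply: contra g0 => /eqP <-; apply: mem_nth.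
Qed.

Lemma conj_partP g i j : is_part g -> (i < conj_part g j)%N = (j < nth 0 g i)%N.
Proof.
move=> gp; rewrite /conj_part -[g in count _ g](mkseq_nth 0%N) /mkseq count_map.
apply: (@count_initial_segment (fun i => j < nth 0 g i)%N) => [a b ab h|a h].
  exact: leq_trans h (nth_part_le gp ab).
by rewrite -(nth_part_gt0 a gp); apply: leq_ltn_trans h.
Qed.

Lemma durfeeP g i : is_part g -> (i < durfee g)%N = (i < nth 0 g i)%N.
Proof.
move=> gp; apply: (@count_initial_segment (fun i => i < nth 0 g i)%N) => [a b ab h|a h].
  exact: leq_ltn_trans ab (leq_trans h (nth_part_le gp ab)).
by rewrite -(nth_part_gt0 a gp); apply: leq_ltn_trans h.
Qed.

Lemma incr_self_map (f : nat -> nat) d :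
  (forall i j, (i < j)%N -> (j < d)%N -> (f i < f j)%N) ->
  (forall i, (i < d)%N -> (f i < d)%N) -> forall i, (i < d)%N -> f i = i.
Proof.
move=> fi fd.
have h1 i j : (i + j < d)%N -> (f i + j <= f (i + j))%N.
  elim: j => [|j IH]; first by rewrite !addn0.
  rewrite addnS => ij; have := IH (ltnW ij); have := fi (i + j)%N _ (ltnSn _) ij; lia.
move=> i id.
have := h1 0%N i id; have := h1 i (d - i.+1)%N; have := fd (i + (d - i.+1))%N.
by rewrite add0n (_ : i + (d - i.+1) = d.-1)%N; lia.
Qed.

Section ArmLeg.
Variables (n : nat) (g : seq nat).
Hypotheses (gp : is_part g) (gn : (size g <= n)%N).
Let G i := nth 0%N g i.
Let Q i := (G i + (n - i.+1))%N.

Let G_le i j : (i <= j)%N -> (G j <= G i)%N. Proof. exact: nth_part_le. Qed.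

Let Gn i : (n <= i)%N -> G i = 0%N.
Proof. by move=> ni; rewrite /G nth_default // (leq_trans gn). Qed.

(* The positions below n missed by the n - i + g_i correspond to the legs. *)
Lemma missing_position k : (k < n)%N -> (forall b, (b < n)%N -> Q b <> k) ->
  exists2 i, (k + conj_part g i = n + i)%N & (i < G i)%N.
Proof.
move=> kn Qk.
have [|e /andP[_ en] he] := @find_initial_segment (fun b => k < Q b)%N 0 n (leq0n n).
  by move=> j j' _ jj' j'n; have := G_le jj'; rewrite /Q; lia.
have hn : (n <= k + e)%N.
  case: (ltnP e n) => e1; last lia.
  have h : (0 <= e < n)%N by rewrite e1.
  by have := he _ h; have := Qk _ e1; rewrite ltnn /Q; lia.
have ce : conj_part g (k + e - n) = e.
  apply/eqP; rewrite eqn_leq; apply/andP; split; rewrite leqNgt.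
    rewrite (conj_partP _ _ gp) -leqNgt -/(G _); case: (ltnP e n) => e1; last by rewrite Gn.
    have h : (0 <= e < n)%N by rewrite e1.
    by have := he _ h; have := Qk _ e1; rewrite ltnn /Q; lia.
  apply/negP => lt; have e0 : (0 < e)%N by lia.
  have : (conj_part g (k + e - n) <= e.-1)%N by lia.
  rewrite leqNgt (conj_partP _ _ gp) -/(G _) => /negP[].
  have h : (0 <= e.-1 < n)%N by lia.
  by have := he _ h; rewrite /Q; lia.
exists (k + e - n)%N; first by rewrite ce; lia.
by rewrite /G -(conj_partP _ _ gp) ce; lia.
Qed.

(** The arm-leg condition says [G i = conj_part g i + 1] for [i < G i]. Then [Q a + Q b = 2n] with
    [a < G a] would give [conj_part g a + G b = a + b + 1], but this sum is at least [a + b + 2] or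
    at most [a + b], as the cell [(b, a)] lies in [g] or not. *)
Lemma arm_leg_antipode :
  (forall i, (i < durfee g)%N -> arm g i = (leg g i).+1) <->
  (forall i, (i < n)%N -> (Q i <= n.*2)%N) /\
  (forall a b, (a < n)%N -> (b < n)%N -> (Q a + Q b)%N <> n.*2).
Proof.
have E1 : (forall i, (i < durfee g)%N -> arm g i = (leg g i).+1) <->
          (forall i, (i < G i)%N -> G i = (conj_part g i).+1).
  have cG i : (i < conj_part g i)%N = (i < G i)%N by rewrite conj_partP.
  have aG i : arm g i = (G i - i.+1)%N by [].
  split=> H i; have := H i; rewrite (durfeeP _ gp) -/(G i) aG /leg => h ig.
    by have := h ig; have := ig; rewrite -cG; lia.
  by have := h ig; have := ig; rewrite -cG; lia.
rewrite E1; split=> [H|[Qn Qaf]].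
  split=> [i im|].
    have h1 : (G 0 <= n.+1)%N.
      case: (posnP (G 0)) => [-> //|h]; rewrite (H _ h) ltnS.
      by apply: leq_trans (count_size _ _) gn.
    by have := G_le (leq0n i); rewrite /Q; lia.
  have main a b : (a < n)%N -> (b < n)%N -> (a < G a)%N -> (Q a + Q b)%N <> n.*2.
    move=> an bn aG; have e1 := H _ aG; rewrite /Q => e.
    case: (ltnP b (conj_part g a)) => h; have := h.
      by rewrite (conj_partP _ _ gp) -/(G b); lia.
    by rewrite leqNgt (conj_partP _ _ gp) -/(G b); lia.
  move=> a b an bn; case: (ltnP a (G a)) => aG; first exact: main.
  case: (ltnP b (G b)) => bG; first by rewrite addnC; apply: main.
  by rewrite /Q; lia.
have inn i : (i < G i)%N -> (i < n)%N.
  by move=> h; case: (ltnP i n) => // /Gn e; move: h; rewrite e.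
have G2 i : (i < G i)%N -> (i.+1 < G i)%N.
  by move=> h; have im := inn _ h; have := Qaf i i im im; rewrite /Q; lia.
have cdec i j : (i <= j)%N -> (conj_part g j <= conj_part g i)%N.
  move=> ij; rewrite leqNgt (conj_partP _ _ gp) -leqNgt.
  have := ltnn (conj_part g i); rewrite (conj_partP _ _ gp) => /negbT; lia.
(* Conversely [2n - Q i] is a missed position, so it comes from the leg of some [i']. The map from
   [i] to [i'] is strictly increasing on the Durfee range, hence the identity. *)
have ex i : exists i', (i < G i)%N ->
    (i' < G i')%N /\ (G i + i' = conj_part g i' + i + 1)%N.
  case: (ltnP i (G i)) => iG; last by exists 0%N.
  have im := inn _ iG; have Qi := Qn _ im; have g2 := G2 _ iG.
  have kn : (n.*2 - Q i < n)%N by rewrite /Q; lia.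
  have [|i' e1 e2] := @missing_position (n.*2 - Q i) kn.
    by move=> b bn e; have := Qaf i b im bn; lia.
  by exists i' => _; split=> //; move: e1 Qi; rewrite /Q; lia.
have [f hf] := choice ex.
move=> i iG; have [fG e] := hf i iG.
have -> : G i = ((conj_part g (f i)).+1 + i - f i)%N by lia.
suff -> : f i = i by lia.
apply: (@incr_self_map f (durfee g)); last by rewrite durfeeP.
  move=> a b ab; rewrite durfeeP // -/(G b) => bG.
  have aG : (a < G a)%N by have := G_le (ltnW ab); lia.
  have [fa ea] := hf _ aG; have [fb eb] := hf _ bG.
  rewrite ltnNge; apply/negP => h; have := cdec _ _ h; have := G_le (ltnW ab); lia.
by move=> a; rewrite !durfeeP // => /hf[].
Qed.

End ArmLeg.

(** * The two sums as determinants *)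

Lemma skew_diagE n mu g : (size mu <= n)%N ->
  skew_diag mu g = cells n (nth 0%N g) (nth 0%N mu).
Proof.
move=> mn; rewrite /cells -(subnKC mn) iotaD add0n map_cat flatten_cat.
rewrite [X in _ ++ X](_ : _ = [::]) ?cats0 //.
case E : flatten => [//|c s]; have := mem_head c s; rewrite -E.
move=> /allpairsPdep[i [j [+ + _]]]; rewrite !mem_iota => /andP[h _].
by rewrite (nth_default _ h); lia.
Qed.

Lemma part_leP g mu : part_le g mu -> forall i, (nth 0 g i <= nth 0 mu i)%N.
Proof.
move=> /allP H i; case: (ltnP i (size g)) => h; last by rewrite nth_default.
by apply: H; rewrite mem_iota.
Qed.

Lemma part_decreasing_on n mu : is_part mu -> decreasing_on n (nth 0%N mu).
Proof. by move=> mp i _; apply: nth_part_le. Qed.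

(** Jacobi-Trudi, including [g] not contained in [mu]: a row where [g] exceeds [mu] gives a zero
    block. *)
Lemma skew_schur_det (R : comNzRingType) n N (z : seq R) mu g :
  is_part mu -> (size mu <= n)%N -> is_part g -> (size g <= n)%N ->
  (nth 0 mu 0 + n <= N)%N ->
  skew_schur z mu g = \det (\matrix_(i < n, j < n)
    ('X^(nth 0%N g i + (n - i.+1)) * \prod_(a < size z) geom N z`_a)
       `_(nth 0%N mu j + (n - j.+1))).
Proof.
move=> mp mn gp gn muN; rewrite /skew_schur; case: ifP => gmu.
  have rk_onto r : (r < size z)%N -> exists a : 'I_(size z), a = r :> nat.
    by move=> h; exists (Ordinal h).
  have := @skew_det R _ _ (size z) (fun a => z`_a) (@ord_inj (size z)) rk_onto n N
    (nth 0%N g) (part_decreasing_on gp) (size z) (nth 0%N mu) (leqnn _)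
    (part_decreasing_on mp) _ _.
  move=> <-; last 2 first.
  - by move=> i _; apply: leq_trans muN; rewrite leq_add2r nth_part_le.
  - by move=> i _; apply: part_leP.
  rewrite -(skew_diagE _ mn) /fsum; apply: eq_bigl => T.
  have -> : below (@nat_of_ord (size z)) (size z) T.
    by apply/forallP => b; rewrite ltn_ord.
  rewrite andbT; apply: eq_forallb => b; apply: eq_forallb => c.
  by rewrite /row_ok /col_ok /= andbT andbF orbF -val_eqE /= orbC -leq_eqVlt.
move/negbT: gmu => /allPn[i]; rewrite mem_iota add0n -ltnNge => /andP[_ ig] lt.
have im : (i < n)%N by apply: leq_trans gn.
rewrite (@det_zero_block _ _ _ (Ordinal im)) //= => k j /= ki ij.
rewrite mxE coefXnM ifT //; have := nth_part_le gp ki; have := nth_part_le mp ij.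
by have := ltn_ord j; lia.
Qed.

(** * Increasing sequences and the partitions of the arm-leg set *)

Section Parts.
Variable n : nat.
Implicit Type q : {ffun 'I_n -> 'I_n.*2.+1}.

(** The sequence is increasing and the parts decreasing, hence the reversal of indices; zero parts
    are dropped to meet [is_part]. *)
Definition part_of q : seq nat :=
  filter (leq 1) (mkseq (fun i => ext q (n - i.+1) - (n - i.+1))%N n).

Lemma nth_filter_pos s i : sorted geq s -> nth 0%N (filter (leq 1) s) i = nth 0%N s i.
Proof.
elim: s i => [|a s IH] i //= sa; have ss := path_sorted sa.
case: ltnP => a0; first by case: i => [//|i] /=; apply: IH.
have a0' : a = 0%N by lia.
have gtr : transitive geq by move=> u v w /= h1 h2; apply: leq_trans h2 h1.
have s0 : all (geq a) s := order_path_min gtr sa.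
rewrite IH //; case: i => [|i] /=; last first.
  case: (ltnP i (size s)) => h; last by rewrite !nth_default // leqW.
  have /allP/(_ _ (mem_nth 0%N h)) := s0; rewrite a0' /= leqn0 => /eqP ->.
  case: (ltnP i.+1 (size s)) => h'; last by rewrite nth_default.
  by have /allP/(_ _ (mem_nth 0%N h')) := s0; rewrite a0' /= leqn0 => /eqP ->.
case: s {IH sa ss} s0 => //= b s /andP[+ _]; rewrite a0'; lia.
Qed.

Lemma ext_le q j : (ext q j <= n.*2)%N.
Proof.
case: (ltnP j n) => h; last by rewrite /ext insubN -?leqNgt.
by rewrite -[j]/(val (Ordinal h)) extE -ltnS ltn_ord.
Qed.

Lemma ext_incr q : incr q -> incr_on n (ext q).
Proof.
move=> /incrP qi i j ij jn; have im := ltn_trans ij jn.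
by rewrite -[i]/(val (Ordinal im)) -[j]/(val (Ordinal jn)) !extE; apply: qi.
Qed.

Lemma ext_ge q j : incr q -> (j < n)%N -> (j <= ext q j)%N.
Proof.
move=> /ext_incr qi; elim: j => // j IH jn.
by have := IH (ltnW jn); have := qi j j.+1 (ltnSn j) jn; lia.
Qed.

Lemma part_of_sorted q : incr q ->
  sorted geq (mkseq (fun i => ext q (n - i.+1) - (n - i.+1))%N n).
Proof.
move=> qi; apply/(sortedP 0%N) => i; rewrite size_mkseq => im.
rewrite !nth_mkseq //=; last exact: ltnW.
have h : (n - i.+2 < n - i.+1)%N by lia.
have h2 : (n - i.+1 < n)%N by lia.
by have := ext_incr qi h h2; lia.
Qed.

Lemma nth_part_of q i : incr q -> (i < n)%N ->
  (nth 0 (part_of q) i + (n - i.+1) = ext q (n - i.+1))%N.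
Proof.
move=> qi im; rewrite nth_filter_pos ?part_of_sorted // nth_mkseq // subnK //.
by apply: ext_ge => //; lia.
Qed.

Lemma part_of_part q : incr q -> is_part (part_of q) /\ (size (part_of q) <= n)%N.
Proof.
move=> qi; split; last first.
  by rewrite size_filter; apply: leq_trans (count_size _ _) _; rewrite size_mkseq.
apply/andP; split; last by rewrite mem_filter.
apply: sorted_filter; last exact: part_of_sorted.
by move=> u v w /= h1 h2; apply: leq_trans h2 h1.
Qed.

Lemma part_ext g g' : is_part g -> is_part g' -> nth 0%N g =1 nth 0%N g' -> g = g'.
Proof.
move=> gp gp' e; apply: (@eq_from_nth _ 0%N) => [|i _]; last exact: e.
have h i : (i < size g)%N = (i < size g')%N by rewrite -!nth_part_gt0 // e.
by case: (ltngtP (size g) (size g')) => // lt; [have := h (size g) | have := h (size g')];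
   rewrite lt ltnn.
Qed.

Lemma part_of_arm_leg q : incr q -> antipode_free n (ext q) ->
  arm_leg_parts (part_of q).
Proof.
move=> qi qf; have [gp gn] := part_of_part qi; split=> //.
apply/(arm_leg_antipode gp gn); split=> [i im|a b an bn].
  by rewrite nth_part_of // ext_le.
by rewrite !nth_part_of //; apply: qf; lia.
Qed.

Lemma arm_leg_part_of g : arm_leg_parts g -> (size g <= n)%N ->
  exists q, [/\ incr q, antipode_free n (ext q) & part_of q = g].
Proof.
move=> [gp ga] gn; have /(arm_leg_antipode gp gn)[h1 h2] := ga.
pose q : {ffun 'I_n -> 'I_n.*2.+1} :=
  [ffun j : 'I_n => inord (nth 0%N g (n - j.+1) + j)].
have qE j : (j < n)%N -> ext q j = (nth 0%N g (n - j.+1) + j)%N.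
  move=> jn; rewrite -[j]/(val (Ordinal jn)) extE ffunE inordK //= ltnS.
  have h : (n - j.+1 < n)%N by lia.
  by have := h1 _ h; rewrite (_ : n - (n - j.+1).+1 = j)%N //; lia.
have qi : incr q.
  apply/incrP => i j ij; rewrite -!(extE q) !qE //.
  have h : (n - j.+1 <= n - i.+1)%N by lia.
  by apply: leq_ltn_trans (_ : _ <= nth 0%N g (n - j.+1) + i)%N _;
     rewrite ?leq_add2r ?ltn_add2l // nth_part_le.
exists q; split=> //.
  move=> i j im jn; rewrite !qE //.
  have hi : (n - i.+1 < n)%N by lia.
  have hj : (n - j.+1 < n)%N by lia.
  have := h2 _ _ hi hj.
  have -> : (n - (n - i.+1).+1 = i)%N by lia.
  by have -> : (n - (n - j.+1).+1 = j)%N by lia.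
have [qp qn] := part_of_part qi; apply: part_ext => // i.
case: (ltnP i n) => im; last by rewrite !nth_default // (leq_trans _ im).
have h : (n - i.+1 < n)%N by lia.
have := nth_part_of qi im; rewrite qE // (_ : n - (n - i.+1).+1 = i)%N; last lia.
by move/eqP; rewrite eqn_add2r => /eqP.
Qed.

Lemma part_of_inj q q' : incr q -> incr q' -> part_of q = part_of q' -> q = q'.
Proof.
move=> qi qi' e; apply/ffunP => j; apply: val_inj => /=; have jn := ltn_ord j.
have h : (n - j.+1 < n)%N by lia.
have := nth_part_of qi h; rewrite e (nth_part_of qi' h).
by rewrite (_ : n - (n - j.+1).+1 = j)%N ?extE //; lia.
Qed.

(** The left side runs over an infinite set; partitions with more than [n] parts contribute nothing,
    and the others are parametrized by [q]. *)
Lemma sum_arm_leg (V : nmodType) (f : seq nat -> V) :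
  (forall g, is_part g -> (n < size g)%N -> f g = 0) ->
  \sum_(g \in arm_leg_parts) f g =
  \sum_(q | incr q && `[< antipode_free n (ext q) >]) f (part_of q).
Proof.
move=> f0; pose p q := incr q && `[< antipode_free n (ext q) >].
pose L := [seq part_of q | q <- enum p].
have uL : uniq L.
  rewrite map_inj_in_uniq ?enum_uniq // => q q'; rewrite !mem_enum.
  by move=> /andP[qi _] /andP[qi' _]; apply: part_of_inj.
transitivity (\sum_(g \in [set` L]%classic) f g).
  apply/esym/fsbig_widen => [g /= /mapP[q]|g [ga gL]].
    by rewrite mem_enum => /andP[qi /asboolP qf] ->; apply: part_of_arm_leg.
  rewrite /preimage /=; case: (leqP (size g) n) => gn; last by apply: f0 => //; case: ga.
  have [q [qi qf e]] := arm_leg_part_of ga gn; case: gL; rewrite /= -e.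
  by apply: map_f; rewrite mem_enum; apply/andP; split=> //; apply/asboolP.
by rewrite -fsbig_seq // /L big_map big_enum.
Qed.

End Parts.

(** Cauchy-Binet with the matrix [antipode_coef]: by [det_antipode] its minors select the
    antipode-free [q], and the product matrix has two terms per entry. *)
Lemma sum_antipode (R : comNzRingType) n (G : nat -> {poly R}) (pos : nat -> nat) :
  \sum_(q : {ffun 'I_n -> 'I_n.*2.+1} | incr q && `[< antipode_free n (ext q) >])
    \det (\matrix_(i < n, j < n) (G (q i))`_(pos j)) =
  \det (\matrix_(k < n, j < n)
    (G k + (-1) ^+ (n - k.+1) *: G (n.*2 - k)%N)`_(pos j)).
Proof.
have -> : \matrix_(k < n, j < n) (G k + (-1) ^+ (n - k.+1) *: G (n.*2 - k)%N)`_(pos j)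
  = \matrix_(k < n, j < n)
      \sum_(q < n.*2.+1) antipode_coef R n k q * (G q)`_(pos j).
  apply/matrixP => k j; rewrite !mxE coefD coefZ; have kn := ltn_ord k.
  under eq_bigr => q _ do rewrite /antipode_coef mulrDl.
  have kl : (k < n.*2.+1)%N by lia.
  have kh : (n.*2 - k < n.*2.+1)%N by lia.
  rewrite big_split /=; congr (_ + _).
    rewrite (bigD1 (Ordinal kl)) //= eqxx mul1r big1 ?addr0 // => q.
    by rewrite -val_eqE /= => /negPf ->; rewrite mul0r.
  rewrite (bigD1 (Ordinal kh)) //= eqxx mulr1 big1 ?addr0 // => q.
  by rewrite -val_eqE /= => /negPf ->; rewrite mulr0 mul0r.
rewrite (cauchy_binet (fun (k : 'I_n) (q : 'I_n.*2.+1) => antipode_coef R n k q)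
  (fun q j => (G q)`_(pos j))).
rewrite big_mkcondr; apply: eq_bigr => q qi.
have -> : \matrix_(k < n, j < n) antipode_coef R n k (q j) =
          \matrix_(k < n, j < n) antipode_coef R n k (ext q j).
  by apply/matrixP => k j; rewrite !mxE extE.
rewrite det_antipode; first by case: asboolP; rewrite ?mul1r ?mul0r.
  exact: ext_incr.
by move=> j _; apply: ext_le.
Qed.

(** The factors strictly between [k] and [2n - k] are the middle one and the pairs [j], [2n - j]. *)
Lemma prod_symmetric (R : comNzRingType) n (f : nat -> R) k : (k < n)%N ->
  \prod_(k.+1 <= b < n.*2 - k) f b =
  f n * \prod_(j < n | (k < j)%N) (f j * f (n.*2 - j)%N).
Proof.
move=> kn; rewrite big_split /=.
rewrite (@big_cat_nat _ _ _ n k.+1 (n.*2 - k)) //=; last lia.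
rewrite [X in _ * X]big_ltn; last lia.
rewrite mulrCA; congr (_ * (_ * _)); first by rewrite big_geq_mkord.
rewrite big_nat_rev /= -[RHS](big_geq_mkord k.+1 n xpredT (fun j => f (n.*2 - j)%N)).
rewrite -[X in \prod_(X <= _ < _) _ = _](_ : (k.+1 + (n - k))%N = n.+1); last lia.
rewrite -[X in \prod_(_ <= _ < X) _ = _](_ : (n + (n - k))%N = n.*2 - k)%N; last lia.
rewrite big_addn (_ : n + (n - k) - (n - k) = n)%N; last lia.
apply: eq_big_nat => b hb; congr f; lia.
Qed.

Lemma sum_skew_schur (R : comNzRingType) n N (z : seq R) mu :
  is_part mu -> (size mu <= n)%N -> (nth 0%N mu 0 + n <= N)%N ->
  \sum_(g \in arm_leg_parts) skew_schur z mu g =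
  \det (\matrix_(m < n, j < n)
    (('X^(n - m.+1) + (-1) ^+ (n - (n - m.+1).+1) *: 'X^(n.*2 - (n - m.+1))) *
      \prod_(a < size z) geom N z`_a)`_(nth 0%N mu j + (n - j.+1))).
Proof.
move=> mp mn muN; rewrite (@sum_arm_leg n); last first.
  move=> g gp gn; rewrite /skew_schur; case: ifP => // /part_leP/(_ n).
  by rewrite (nth_default 0%N mn) leqNgt nth_part_gt0 // gn.
set H := \prod_(a < size z) geom N z`_a.
(* [part_of] reads [q] backwards, so rows and columns are reversed to match an increasing [q]. *)
rewrite -[RHS]det_rev.
transitivity (\det (\matrix_(k < n, j < n)
   ('X^k * H + (-1) ^+ (n - k.+1) *: ('X^(n.*2 - k) * H))`_
     (nth 0%N mu (n - j.+1) + j))); last first.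
  congr (\det _); apply/matrixP => k j; rewrite !mxE /= !subnS.
  have kn := ltn_ord k; have jn := ltn_ord j.
  have e1 : (n - (n - k.+1).+1 = k)%N by lia.
  have e2 : (n - (n - j.+1).+1 = j)%N by lia.
  by rewrite -!subnS e1 e2 mulrDl scalerAl.
rewrite -(@sum_antipode _ n (fun k => 'X^k * H) (fun j => nth 0%N mu (n - j.+1) + j)%N).
apply: eq_bigr => q /andP[qi _]; have [gp gn] := part_of_part qi.
rewrite (skew_schur_det z mp mn gp gn muN) -det_rev.
congr (\det _); apply/matrixP => k j; rewrite !mxE /=.
have kn := ltn_ord k; have jn := ltn_ord j.
have h : (n - k.+1 < n)%N by lia.
have e1 : (n - (n - k.+1).+1 = k)%N by lia.
have e2 : (n - (n - j.+1).+1 = j)%N by lia.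
by rewrite (nth_part_of qi h) e1 e2 extE.
Qed.

(** * The tableau sum and the product formula *)

Section Assembly.
Variables (F : fieldType) (n : nat) (x y : 'I_n -> F) (z0 : F).
Hypothesis (x_neq0 : forall i, x i != 0) (y_neq0 : forall i, y i != 0).
Hypothesis (z0_neq0 : z0 != 0).

Let zz := plain_wt x y z0.

Lemma plain_wtE (s : symbol n) : zz (symbol_rank s) =
  match s with Plain k => x k | Zero => z0 | Bar k => (y k)^-1 end.
Proof. exact: nth_zvec. Qed.

Lemma symbol_of_rank a : (a <= n.*2)%N -> exists s : symbol n, symbol_rank s = a.
Proof.
move=> an; have h : (a.*2.+1 < n.*2.+1.*2)%N by lia.
have [s es] := rank_onto h.
by exists s.1; rewrite -half_rank es /= uphalf_double.
Qed.

Lemma plain_wt_neq0 a : (a <= n.*2)%N -> zz a != 0.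
Proof.
move=> /symbol_of_rank[s <-]; rewrite plain_wtE.
by case: s => [k||k] //; rewrite invr_eq0.
Qed.

Lemma primed_wtE a : (a <= n.*2)%N -> primed_wt x y z0 a = (zz (n.*2 - a))^-1.
Proof.
move=> /symbol_of_rank[s <-].
pose s' : symbol n := match s with Plain k => Bar k | Zero => Zero | Bar k => Plain k end.
have -> : (n.*2 - symbol_rank s)%N = symbol_rank s'.
  by case: (s) @s' => [k||k] /=; try have := ltn_ord k; lia.
by rewrite plain_wtE /primed_wt nth_zvec; case: (s) @s' => [k||k] //=; rewrite invrK.
Qed.

Lemma zz_low (k : 'I_n) : zz k = x k.
Proof. exact: (plain_wtE (Plain k)). Qed.

Lemma zz_mid : zz n = z0.
Proof. exact: (plain_wtE Zero). Qed.

Lemma zz_high (k : 'I_n) : zz (n.*2 - k) = (y k)^-1.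
Proof. exact: (plain_wtE (Bar k)). Qed.

Lemma diag_wt_low k : (k < n)%N ->
  diag_wt x y z0 k = \prod_(k <= b < n.*2 - k) zz b.
Proof.
move=> kn; rewrite big_ltn; last lia.
rewrite prod_symmetric // /diag_wt -[k in insub k]/(val (Ordinal kn)) valK /wgt_diag /=.
rewrite zz_mid -(zz_low (Ordinal kn)) /= [RHS]mulrCA mulrA; congr (_ * _).
by apply: eq_bigr => j _; rewrite zz_low zz_high.
Qed.

Lemma diag_wt_high k : (k < n)%N -> diag_wt x y z0 (n.*2 - k) = 1.
Proof. by move=> kn; rewrite /diag_wt insubN //; lia. Qed.

(** Both sums become determinants read at the same positions, one with [num_poly] and one with
    [antipode_poly]; [det_num_poly] compares them. *)
Lemma tableau_sum_staircase mu : is_part mu -> (size mu <= n)%N ->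
  tableau_sum x y z0 (add_staircase n mu) =
  (\prod_(k < n) diag_factor n zz k) *
  (\sum_(g \in arm_leg_parts) skew_schur (zvec x y z0) mu g).
Proof.
move=> mp mn; pose lam := add_staircase n mu; pose N := (nth 0%N mu 0 + n).+1.
have lamE i : (i < n)%N -> nth 0%N lam i = (nth 0%N mu i + (n - i))%N.
  by move=> im; rewrite /lam /add_staircase nth_mkseq.
rewrite tableau_sumE; first 1 last.
- by rewrite size_mkseq.
- move=> i im; rewrite -/lam !lamE //; last exact: ltnW.
  by have := nth_part_le mp (leqnSn i); lia.
- by move=> i im; rewrite -/lam lamE //; lia.
have szz : size (zvec x y z0) = n.*2.+1.
  by rewrite /zvec size_cat /= size_rev !size_codom card_ord addnS addnn.
rewrite (@sum_skew_schur _ n N) //.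
rewrite szz -(big_mkord xpredT (fun a => geom N (zvec x y z0)`_a)) -/(h_poly n zz N).
rewrite -(det_num_poly plain_wt_neq0 (h_poly n zz N) (fun j => nth 0%N mu j + (n - j.+1))%N).
transitivity (\sum_(q : {ffun 'I_n -> 'I_n.*2.+1} | incr q && `[< antipode_free n (ext q) >])
   \det (\matrix_(i < n, j < n)
     (path_poly n zz (primed_wt x y z0) (diag_wt x y z0) N (q i))`_(nth 0%N lam j))).
  apply: eq_bigr => q /andP[qi _].
  have rows_le i : (i < n)%N -> (i + nth 0 lam i < N)%N.
    by move=> im; rewrite lamE // /N; have := nth_part_le mp (leq0n i); lia.
  rewrite (@shifted_det _ _ _ n.*2.+1 (@rank_inj n) (@rank_onto n) _ _ _ n N) //.
  - congr (\det _); apply/matrixP => i j; rewrite !mxE /row_entry ifF.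
      rewrite addKn row_polyE ?extE //.
    by apply/negbTE; rewrite -ltnNge -/lam lamE //; have := ltn_ord j; lia.
  - exact: ext_incr.
  - split=> [j _|j jn _]; first by rewrite leq_addr.
    rewrite !lamE //; last exact: ltnW.
    by have := nth_part_le mp (leqnSn j); lia.
  - by move=> j jn _; rewrite lamE //; lia.
rewrite (@sum_antipode _ n _ (fun j => nth 0%N lam j)).
congr (\det _); apply/matrixP => k j; rewrite !mxE coefD coefZ.
have kn := ltn_ord k; have jn := ltn_ord j.
have lN : (nth 0 lam j < N)%N.
  by rewrite lamE // /N; have := nth_part_le mp (leq0n j); lia.
rewrite !(path_poly_trunc _ _ _ lN); try lia.
rewrite -coefZ -coefD [(-1) ^+ _ *: _]scalerAl -mulrDl.
rewrite (num_polyE plain_wt_neq0 primed_wtE diag_wt_low diag_wt_high kn).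
(* The factor ['X] of the diagonal cells lowers [mu_j + (n - j)] to [mu_j + (n - j.+1)], the
   position on the Schur side. *)
rewrite -mulrA coefXM lamE // ifF; last lia.
by congr (_`_ _); lia.
Qed.

Lemma prod_diag_factor :
  \prod_(k < n) diag_factor n zz k =
    (\prod_(i < n) x i ^- (n - i.+1)) *
    (\prod_(i < n) (1 + z0 * x i)) *
    (\prod_(i < n) \prod_(j < n | (i < j)%N)
       ((1 + x i * x j) * (1 + x i * (y j)^-1))).
Proof.
rewrite -!big_split; apply: eq_bigr => k _ /=.
rewrite /diag_factor prod_symmetric ?ltn_ord // zz_mid zz_low -mulrA [x k * z0]mulrC.
congr (_ * (_ * _)); apply: eq_bigr => j _.
by rewrite zz_low zz_high.
Qed.

Lemma sum_skew_schur_nil (z : seq F) :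
  \sum_(g \in arm_leg_parts) skew_schur z [::] g = 1.
Proof.
(* The empty partition permits [n = 0], where the determinant is empty. *)
rewrite (@sum_skew_schur _ 0 0) //; exact: det_mx00.
Qed.

End Assembly.

Theorem theorem6 (F : fieldType) (n : nat) (mu : seq nat)
    (x y : 'I_n -> F) (z0 : F)
    (mu_part : is_part mu) (mu_size : (size mu <= n)%N)
    (x_neq0 : forall i, x i != 0) (y_neq0 : forall i, y i != 0)
    (z0_neq0 : z0 != 0) :
  tableau_sum x y z0 (add_staircase n mu) =
    tableau_sum x y z0 (staircase n) *
    (\sum_(g \in arm_leg_parts) skew_schur (zvec x y z0) mu g)
  /\
  tableau_sum x y z0 (staircase n) =
    (\prod_(i < n) x i ^- (n - i.+1)) *
    (\prod_(i < n) (1 + z0 * x i)) *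
    (\prod_(i < n) \prod_(j < n | (i < j)%N)
       ((1 + x i * x j) * (1 + x i * (y j)^-1))).
Proof.
(* The empty [mu] identifies the common factor with the staircase sum. *)
have dE : tableau_sum x y z0 (staircase n) =
    \prod_(k < n) diag_factor n (plain_wt x y z0) k.
  have -> : staircase n = add_staircase n [::].
    by apply: eq_mkseq => i; rewrite nth_nil.
  by rewrite tableau_sum_staircase // sum_skew_schur_nil mulr1.
by rewrite dE tableau_sum_staircase // prod_diag_factor.
Qed.
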